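(* Let $T(\mathcal{Y})$ be the standard equilateral triangle with vertices $(0,0),(1,0),(1/2,\sqrt3/2)$, let $r\in[1,\infty]$ and $\epsilon\in[0,\sqrt3/3)$, and let $X_1,\dots,X_n$ be i.i.d. according to the segregation alternative $H^S_\epsilon$. Let $\mu_S(r,\epsilon)=\mathbf{E}^S_\epsilon[\rho_n(r)]=\frac12\mathbf{E}^S_\epsilon[h_{12}]$ and $\nu_S(r,\epsilon)=\mathbf{Cov}^S_\epsilon[h_{12},h_{13}]$. Then for all $(r,\epsilon)$ with $\nu_S(r,\epsilon)>0$, $$\sqrt{n}\,\big(\rho_n(r)-\mu_S(r,\epsilon)\big)\xrightarrow{\mathcal{L}}\mathcal{N}(0,\nu_S(r,\epsilon)).$$ Likewise, under the association alternative $H^A_\epsilon$, with $\mu_A(r,\epsilon)=\mathbf{E}^A_\epsilon[\rho_n(r)]$ and $\nu_A(r,\epsilon)=\mathbf{Cov}^A_\epsilon[h_{12},h_{13}]$, one has $\sqrt{n}(\rho_n(r)-\mu_A(r,\epsilon))\xrightarrow{\mathcal{L}}\mathcal{N}(0,\nu_A(r,\epsilon))$ whenever $\nu_A(r,\epsilon)>0$.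
   Context: $r$-factor proximity map $N^r_{\mathcal{Y}}$: the triangle is split into vertex regions $R(\mathsf{y}_j)$ by segments from its center of mass to the edge midpoints. For $x\in T(\mathcal{Y})\setminus\mathcal{Y}$ let $v(x)$ be the vertex whose region contains $x$, $e(x)$ the opposite edge, $\ell(x)$ the line through $x$ parallel to $e(x)$, $\ell_r(x)$ the parallel line on the same side of $v(x)$ with $d(v(x),\ell_r(x))=r\,d(v(x),\ell(x))$, $T_r(x)$ the triangle similar to and with the same orientation as $T(\mathcal{Y})$ with vertex $v(x)$ and opposite edge on $\ell_r(x)$; $N^r_{\mathcal{Y}}(x)=T_r(x)\cap T(\mathcal{Y})$ for $r<\infty$, $N^\infty_{\mathcal{Y}}(x)=T(\mathcal{Y})$, and $N^r_{\mathcal{Y}}(x)=\{x\}$ for $x\in\mathcal{Y}$. $\rho_n(r)$ is the number of ordered pairs $(i,j)$, $i\ne j$, with $X_j\in N^r_{\mathcal{Y}}(X_i)$, divided by $n(n-1)$; $h_{ij}=\mathbf{I}\{X_j\in N^r_{\mathcal{Y}}(X_i)\}+\mathbf{I}\{X_i\in N^r_{\mathcal{Y}}(X_j)\}$. Alternatives: for a vertex $\mathsf{y}$ let $\ell_{\mathsf{y}}(x)$ be the line through $x$ parallel to the edge opposite $\mathsf{y}$ and $T(\mathsf{y},\epsilon)=\{x\in T(\mathcal{Y}):d(\mathsf{y},\ell_{\mathsf{y}}(x))\le\epsilon\}$. Under $H^S_\epsilon$ the $X_i$ are i.i.d. uniform on $T(\mathcal{Y})\setminus\bigcup_{\mathsf{y}\in\mathcal{Y}}T(\mathsf{y},\epsilon)$;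 under $H^A_\epsilon$ they are i.i.d. uniform on $\bigcup_{\mathsf{y}\in\mathcal{Y}}T(\mathsf{y},\sqrt3/3-\epsilon)$. $\mathbf{E}^S_\epsilon,\mathbf{Cov}^S_\epsilon$ (resp. $\mathbf{E}^A_\epsilon,\mathbf{Cov}^A_\epsilon$) denote expectation and covariance under $H^S_\epsilon$ (resp. $H^A_\epsilon$). *)

(* Defs.v *)
From HB Require Import structures.
From mathcomp Require Import all_boot all_order all_algebra.
From mathcomp Require Import all_classical all_reals all_analysis.
Set Implicit Arguments. Unset Strict Implicit. Unset Printing Implicit Defensive.
Import Order.TTheory GRing.Theory Num.Theory.
Local Open Scope classical_set_scope.
Local Open Scope ring_scope.

Section PCS.
Variable R : realType.
Notation pt := (R * R)%type.

Definition padd (p q : pt) : pt := (p.1 + q.1, p.2 + q.2).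
Definition psub (p q : pt) : pt := (p.1 - q.1, p.2 - q.2).
Definition pscale (k : R) (p : pt) : pt := (k * p.1, k * p.2).
Definition pnorm (p : pt) : R := Num.sqrt (p.1 ^+ 2 + p.2 ^+ 2).
Definition cross (p q : pt) : R := p.1 * q.2 - p.2 * q.1.

Definition dist_pt_line (p q u : pt) : R := `|cross (psub p q) u| / pnorm u.

Definition vtx (j : nat) : pt :=
  match (j %% 3)%N with
  | 0 => (0, 0)
  | 1 => (1, 0)
  | _ => (1 / 2, Num.sqrt 3 / 2)
  end.

Definition vertY : set pt := [set vtx j | j in [set j : nat | (j < 3)%N]].

Definition Tri : set pt :=
  [set p | exists a b c : R, [/\ 0 <= a, 0 <= b, 0 <= c, a + b + c = 1 &
     p = padd (pscale a (vtx 0)) (padd (pscale b (vtx 1)) (pscale c (vtx 2)))]].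

Definition conv4 (p1 p2 p3 p4 : pt) : set pt :=
  [set p | exists a b c d : R, [/\ 0 <= a, 0 <= b, 0 <= c & 0 <= d] /\
     a + b + c + d = 1 /\
     p = padd (pscale a p1) (padd (pscale b p2) (padd (pscale c p3) (pscale d p4)))].

Definition midpt (p q : pt) : pt := pscale (1 / 2) (padd p q).

Definition MC : pt := pscale (1 / 3) (padd (vtx 0) (padd (vtx 1) (vtx 2))).

Definition vregion (j : nat) : set pt :=
  conv4 (vtx j) (midpt (vtx j) (vtx j.+1)) MC (midpt (vtx j) (vtx j.+2)).

(* index of the vertex whose region contains x (ties on the measure-zero
   boundaries are broken by the smallest index) *)
Definition vidx (x : pt) : nat :=
  if x \in vregion 0 then 0%N else if x \in vregion 1 then 1%N else 2%N.

Definition oppdir (j : nat) : pt := psub (vtx j.+2) (vtx j.+1).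

Definition dvl (j : nat) (x : pt) : R := dist_pt_line (vtx j) x (oppdir j).

(* triangle similar to T(Y), same orientation, with vertex y_j and opposite edge
   at distance D from y_j (on the side of T(Y)): homothetic image of T(Y)
   centered at y_j with ratio D / d(y_j, opposite edge) *)
Definition simtri (j : nat) (D : R) : set pt :=
  [set padd (vtx j) (pscale (D / dvl j (vtx j.+1)) (psub z (vtx j))) | z in Tri].

Definition Nprox (r : \bar R) (x : pt) : set pt :=
  if x \in vertY then [set x] else
  match r with
  | r'%:E => simtri (vidx x) (r' * dvl (vidx x) x) `&` Tri
  | _ => Tri
  end.

Definition Tvert (j : nat) (eps : R) : set pt := [set x | Tri x /\ dvl j x <= eps].

Definition seg_support (eps : R) : set pt :=
  Tri `\` (Tvert 0 eps `|` Tvert 1 eps `|` Tvert 2 eps).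

Definition assoc_support (eps : R) : set pt :=
  let e := Num.sqrt 3 / 3 - eps in Tvert 0 e `|` Tvert 1 e `|` Tvert 2 e.

Definition leb2 : set pt -> \bar R := (lebesgue_measure \x lebesgue_measure)%E.

Section RV.
Context {d : measure_display} {Omega : measurableType d}.
Variable P : probability Omega R.
Variable X : nat -> Omega -> pt.

Definition iid_uniform (S : set pt) : Prop :=
  [/\ (forall i, measurable_fun setT (X i)),
      (forall i (A : set pt), measurable A ->
         P (X i @^-1` A) = (fine (leb2 (A `&` S)) / fine (leb2 S))%:E) &
      (forall (s : seq nat) (A : nat -> set pt), uniq s ->
         (forall i, measurable (A i)) ->
         fine (P (\big[setI/setT]_(i <- s) (X i @^-1` A i))) =
         \prod_(i <- s) fine (P (X i @^-1` A i)))].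

(* h_{ij} (indices shifted: X_0 is the paper's X_1) *)
Definition hij (r : \bar R) (i j : nat) (w : Omega) : R :=
  \1_(Nprox r (X i w)) (X j w) + \1_(Nprox r (X j w)) (X i w).

Definition rho (n : nat) (r : \bar R) (w : Omega) : R :=
  (\sum_(i < n) \sum_(j < n | j != i) \1_(Nprox r (X i w)) (X j w))
    / ((n * (n - 1))%N)%:R.

Definition mu_h (r : \bar R) : R := fine ('E_P[hij r 0 1])%E / 2.
Definition nu_h (r : \bar R) : R := fine (covariance P (hij r 0 1) (hij r 0 2)).

(* sqrt n (rho_n - m) converges in law to N(0, v) (CDF convergence at every
   point; the limit CDF is continuous) *)
Definition clt_holds (r : \bar R) (m v : R) : Prop :=
  forall t : R,
    (fun n : nat => P [set w | Num.sqrt n%:R * (rho n r w - m) <= t])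
      @ \oo --> normal_prob 0 (Num.sqrt v) [set x | x <= t].

End RV.
End PCS.

(* Main.v *)
(** The statistic is a U-statistic of order two with a bounded measurable symmetric
    kernel [h] evaluated at independent variables [X_i] with a common law.

    Hajek projection: with [g x = E h(x, X_0) - E h(X_0, X_1)], one has
    [rho_n - mu = (1/n) sum_i g(X_i) + R_n], where [R_n] averages a completely
    degenerate kernel. Its off-diagonal covariances vanish, so that
    [n E R_n^2 = O(1/n)], while [E g(X_0)^2] is the covariance of [h_12] and [h_13].

    The central limit theorem for [sum_i g(X_i)] is Lindeberg's argument in Trotter's
    operator form: the commuting contractions [A f x = E f(x + Y)], for [Y] equal to
    [g(X_0)/sqrt n] or to a normal variable with the same first two moments,
    satisfy [|A1^n f - A2^n f| <= n sup |A1 f - A2 f| = O(n^{-1/2})] when [f] has a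
    third-order Taylor bound; [A2^n] is known from the convolution of normal laws.
    A cubic-spline step [f] and Chebyshev's inequality for [R_n] sandwich the
    distribution function. *)

Require Import Defs.
From HB Require Import structures.
From mathcomp Require Import all_boot all_order all_algebra.
From mathcomp Require Import all_classical all_reals all_analysis.
From mathcomp Require Import measurable_realfun ring lra.
Import Order.TTheory GRing.Theory Num.Theory.
Import numFieldNormedType.Exports.
Local Open Scope classical_set_scope.
Local Open Scope ring_scope.
Set Implicit Arguments. Unset Strict Implicit. Unset Printing Implicit Defensive.

(** * Bounded measurable functions *)

(** Independence is given only as a product formula for finite cylinders, whereas every moment needs
    Fubini for functions of several [X i]. The bridge is [indep_off]: a random element independent
    of all variables outside a finite list. It survives adjoining one more variable and applying
    measurable maps, so each expectation is computed by integrating out one variable at a time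
    against a fresh copy of [X 0]. Commutation of the two operators matters because the Taylor bound
    is then needed only for the test function itself, never for its iterated images; a piecewise
    cubic therefore suffices. The mean and variance of the normal law come from comparing densities
    by [1 + y <= expR y], without differentiating under the integral. The width [delta] of the step
    stays fixed while [n] grows and is chosen only at the end, so the constants in the rates may
    depend on it. The geometry enters through one fact: the set of pairs [(x, y)] with [y] in the
    proximity region of [x] is measurable. *)

Section bounded_measurable.
Context {R : realType}.

(** Kernels and test functions are all bounded, so this class replaces integrability side
    conditions: it is stable under products and partial integration, and its members are integrable
    for every probability. *)
Definition bmeas d (T : measurableType d) (f : T -> R) : Prop :=
  measurable_fun setT f /\ exists M : R, forall x, `|f x| <= M.

Section ops.
Context d (T : measurableType d).
Implicit Types f g : T -> R.

Lemma bmeas_cst c : bmeas (fun _ : T => c).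
Proof. by split => //; exists `|c|. Qed.

Lemma bmeasD f g : bmeas f -> bmeas g -> bmeas (fun x => f x + g x).
Proof.
move=> [mf [M fM]] [mg [N gN]]; split; first exact: measurable_funD.
by exists (M + N) => x; rewrite (le_trans (ler_normD _ _))// lerD.
Qed.

Lemma bmeasM f g : bmeas f -> bmeas g -> bmeas (fun x => f x * g x).
Proof.
move=> [mf [M fM]] [mg [N gN]]; split; first exact: measurable_funM.
by exists (M * N) => x; rewrite normrM ler_pM.
Qed.

Lemma bmeasZ c f : bmeas f -> bmeas (fun x => c * f x).
Proof. by move=> bf; apply: bmeasM => //; exact: bmeas_cst. Qed.

Lemma bmeasB f g : bmeas f -> bmeas g -> bmeas (fun x => f x - g x).
Proof.
move=> [mf [M fM]] [mg [N gN]]; split; first exact: measurable_funB.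
by exists (M + N) => x; rewrite (le_trans (ler_normB _ _))// lerD.
Qed.

Lemma bmeas_sum (I : Type) (s : seq I) (Q : pred I) (F : I -> T -> R) :
  (forall i, Q i -> bmeas (F i)) -> bmeas (fun x => \sum_(i <- s | Q i) F i x).
Proof.
move=> bF; elim: s => [|i s IH].
  rewrite (_ : (fun x => _) = fun=> 0); first exact: bmeas_cst.
  by apply/funext => x; rewrite big_nil.
have [Qi|Qi] := boolP (Q i).
  rewrite (_ : (fun x => _) = fun x => F i x + \sum_(j <- s | Q j) F j x).
    by apply: bmeasD => //; exact: bF.
  by apply/funext => x; rewrite big_cons Qi.
rewrite (_ : (fun x => _) = fun x => \sum_(j <- s | Q j) F j x)//.
by apply/funext => x; rewrite big_cons (negbTE Qi).
Qed.

Lemma bmeas_indic (A : set T) : measurable A -> bmeas (\1_A : T -> R).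
Proof.
move=> mA; split; first exact: measurable_indic.
by exists 1 => x; rewrite indicE; case: (_ \in _); rewrite ?normr1 ?normr0.
Qed.

Lemma bmeas_comp d' (U : measurableType d') (h : U -> T) f :
  bmeas f -> measurable_fun setT h -> bmeas (f \o h).
Proof.
by move=> [mf [M fM]] mh; split; [exact: measurableT_comp|exists M => x; exact: fM].
Qed.

End ops.

Section integral.
Context d (T : measurableType d) (P : probability T R).
Implicit Types f g : T -> R.

Lemma bmeas_integrable f : bmeas f -> P.-integrable setT (EFin \o f).
Proof.
move=> [mf [M fM]]; apply: measurable_bounded_integrable => //.
  by rewrite (@le_lt_trans _ _ 1%E) ?ltry//; exact: probability_le1.
exists M; split; first exact: num_real.
by move=> x /ltW Mx y _ /=; exact: le_trans (fM y) Mx.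
Qed.

Lemma Rint_cst c : \int[P]_x c = c.
Proof. by rewrite Rintegral_cst//= probability_setT mulr1. Qed.

Lemma RintD f g : bmeas f -> bmeas g ->
  \int[P]_x (f x + g x) = \int[P]_x f x + \int[P]_x g x.
Proof. by move=> bf bg; apply: RintegralD => //; exact: bmeas_integrable. Qed.

Lemma RintB f g : bmeas f -> bmeas g ->
  \int[P]_x (f x - g x) = \int[P]_x f x - \int[P]_x g x.
Proof. by move=> bf bg; apply: RintegralB => //; exact: bmeas_integrable. Qed.

Lemma RintZ c f : bmeas f -> \int[P]_x (c * f x) = c * \int[P]_x f x.
Proof. by move=> bf; apply: RintegralZl => //; exact: bmeas_integrable. Qed.

Lemma Rint_le f g : bmeas f -> bmeas g -> (forall x, f x <= g x) ->
  \int[P]_x f x <= \int[P]_x g x.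
Proof. by move=> bf bg fg; apply: le_Rintegral => //; exact: bmeas_integrable. Qed.

Lemma Rint_norm_le f M : bmeas f -> (forall x, `|f x| <= M) ->
  `|\int[P]_x f x| <= M.
Proof.
move=> bf fM; rewrite ler_norml -(Rint_cst (- M)) -{2}(Rint_cst M).
by apply/andP; split; apply: Rint_le => //; try exact: bmeas_cst;
  move=> x; have := fM x; rewrite ler_norml => /andP[].
Qed.

Lemma Rint_sum (I : Type) (s : seq I) (Q : pred I) (F : I -> T -> R) :
  (forall i, Q i -> bmeas (F i)) ->
  \int[P]_x (\sum_(i <- s | Q i) F i x) = \sum_(i <- s | Q i) \int[P]_x F i x.
Proof.
move=> bF; elim: s => [|i s IH].
  by rewrite big_nil -[RHS]Rint_cst; apply: eq_Rintegral => x _; rewrite big_nil.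
have [Qi|Qi] := boolP (Q i); rewrite big_cons ?Qi ?(negbTE Qi) -IH.
  rewrite -RintD; [|exact: bF|exact: bmeas_sum].
  by apply: eq_Rintegral => x _; rewrite big_cons Qi.
by apply: eq_Rintegral => x _; rewrite big_cons (negbTE Qi).
Qed.

Lemma Rint_indic (A : set T) : measurable A -> \int[P]_x \1_A x = fine (P A).
Proof. by move=> mA; rewrite /Rintegral integral_indic// setIT. Qed.

End integral.

Section fubini.
Context d1 d2 (T1 : measurableType d1) (T2 : measurableType d2)
  (P1 : probability T1 R) (P2 : probability T2 R) (f : T1 * T2 -> R).
Hypothesis bf : bmeas f.

Lemma bmeas_pair1 y : bmeas (fun x => f (x, y)).
Proof. by apply: bmeas_comp bf _; exact: measurable_fun_pair. Qed.

Lemma bmeas_pair2 x : bmeas (fun y => f (x, y)).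
Proof. by apply: bmeas_comp bf _; exact: measurable_fun_pair. Qed.

Let intf : (P1 \x P2)%E.-integrable setT (EFin \o f).
Proof. exact: bmeas_integrable. Qed.

Let intE1 x : (\int[P2]_y (f (x, y))%:E)%E = (\int[P2]_y f (x, y))%:E.
Proof.
rewrite /Rintegral fineK//.
exact: (integrable_fin_num measurableT (bmeas_integrable P2 (bmeas_pair2 x))).
Qed.

Let intE2 y : (\int[P1]_x (f (x, y))%:E)%E = (\int[P1]_x f (x, y))%:E.
Proof.
rewrite /Rintegral fineK//.
exact: (integrable_fin_num measurableT (bmeas_integrable P1 (bmeas_pair1 y))).
Qed.

Lemma bmeas_Rint2 : bmeas (fun x => \int[P2]_y f (x, y)).
Proof.
split.
  apply/measurable_EFinP.
  have := measurable_fubini_F intf; congr measurable_fun.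
  by apply/funext => x; rewrite /fubini_F /= intE1.
have [_ [M fM]] := bf.
by exists M => x; apply: Rint_norm_le => //; exact: bmeas_pair2.
Qed.

Lemma Rint_prod : \int[(P1 \x P2)%E]_z f z = \int[P1]_x \int[P2]_y f (x, y).
Proof.
rewrite {1}/Rintegral -integral12_prod_meas1// /fubini_F.
by rewrite /Rintegral; congr fine; apply: eq_integral => x _ /=; rewrite intE1.
Qed.

Lemma Rint_swap : \int[P1]_x \int[P2]_y f (x, y) = \int[P2]_y \int[P1]_x f (x, y).
Proof.
rewrite -Rint_prod {1}/Rintegral -integral21_prod_meas1// /fubini_G.
by rewrite /Rintegral; congr fine; apply: eq_integral => x _ /=; rewrite intE2.
Qed.

End fubini.
End bounded_measurable.

(** * Independence *)

Section pair_law.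
Context {R : realType} d (W : measurableType d) (P : probability W R).
Context d1 (V : measurableType d1) d2 (T : measurableType d2).
Variables (U : W -> V) (Y : W -> T).
Hypotheses (mU : measurable_fun setT U) (mY : measurable_fun setT Y).

Let U' : {mfun W >-> V} := HB.pack U (isMeasurableFun.Build _ _ _ _ _ mU).
Let Y' : {mfun W >-> T} := HB.pack Y (isMeasurableFun.Build _ _ _ _ _ mY).

(** The event [D] and the factor [c] serve the induction in [indep_off_pair], where [D] is a
    cylinder over further variables and [c] its probability; [D = setT], [c = 1] is the ordinary
    joint law. Both sides agree on rectangles with the product measure whose first factor is scaled
    by [c], and such a measure is unique. *)
Lemma pair_law_restr (D : set W) (c : R) (mD : measurable D) : 0 <= c ->
  (forall B C, measurable B -> measurable C ->
    P (U @^-1` B `&` Y @^-1` C `&` D) = c%:E * (P (U @^-1` B) * P (Y @^-1` C)))%E ->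
  forall Z, measurable Z ->
    P ((fun w => (U w, Y w)) @^-1` Z `&` D) =
      (c%:E * (distribution P U' \x distribution P Y') Z)%E.
Proof.
move=> c0 rect Z mZ.
have mUY : measurable_fun setT (fun w => (U w, Y w)) by exact: measurable_fun_pair.
pose m' : {measure set (V * T) -> \bar R} :=
  @measure_function_pushforward__canonical__measure_function_Measure
     _ _ _ _ _ (mrestr P mD) _ mUY.
pose m1 : {finite_measure set V -> \bar R} := mscale (NngNum c0) (distribution P U').
have -> : P ((fun w => (U w, Y w)) @^-1` Z `&` D) = m' Z by [].
have <- : (m1 \x distribution P Y')%E Z = m' Z.
  apply: product_measure_unique => // A B mA mB.
  rewrite /m' /m1 /= /pushforward /mrestr /mscale /= /distribution /pushforward /=.
  by rewrite -muleA -rect//; congr (P (_ `&` _)).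
pose m2 : {measure set (V * T) -> \bar R} :=
  mscale (NngNum c0) (distribution P U' \x distribution P Y')%E.
have -> : (c%:E * (distribution P U' \x distribution P Y') Z)%E = m2 Z by [].
apply: product_measure_unique => // A B mA mB.
rewrite /m2 /m1 /= /mscale /= product_measure1E//.
by rewrite muleA.
Qed.

Lemma Rint_pair (f : V * T -> R) :
  (forall B C, measurable B -> measurable C ->
    P (U @^-1` B `&` Y @^-1` C) = P (U @^-1` B) * P (Y @^-1` C))%E ->
  bmeas f ->
  \int[P]_w f (U w, Y w) = \int[P]_w \int[P]_w' f (U w, Y w').
Proof.
move=> rect bf.
have mUY : measurable_fun setT (fun w => (U w, Y w)) by exact: measurable_fun_pair.
pose UY : {mfun W >-> (V * T)%type} := HB.pack (fun w => (U w, Y w))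
  (isMeasurableFun.Build _ _ _ _ _ mUY).
have law : forall Z, measurable Z ->
    distribution P UY Z = (distribution P U' \x distribution P Y')%E Z.
  move=> Z mZ.
  have := @pair_law_restr setT 1 measurableT ler01 _ Z mZ.
  by rewrite setIT mul1e; apply => B C mB mC; rewrite setIT mul1e; exact: rect.
have intd d3 (S : measurableType d3) (G : {mfun W >-> S}) (g : S -> R) : bmeas g ->
    \int[P]_w g (G w) = \int[distribution P G]_x g x.
  move=> bg; rewrite /Rintegral integral_distribution//.
    by case: bg => mg _; apply/measurable_EFinP.
  exact: (bmeas_integrable P (bmeas_comp bg (measurable_funP G))).
rewrite (intd _ _ UY)//.
transitivity (\int[(distribution P U' \x distribution P Y')%E]_z f z).
  by rewrite /Rintegral; congr fine; apply: eq_measure_integral => A mA _; exact: law.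
rewrite Rint_prod// -(intd _ _ U' (fun x => \int[distribution P Y']_y f (x, y))); last first.
  exact: (bmeas_Rint2 (distribution P U') (distribution P Y') bf).
apply: eq_Rintegral => w _.
by rewrite -(intd _ _ Y' (fun y => f (U w, y)))//; exact: bmeas_pair2.
Qed.

End pair_law.

Section iid.
Context {R : realType} d (W : measurableType d) (P : probability W R).
Context d' (T : measurableType d') (X : nat -> W -> T).
Hypothesis mX : forall i, measurable_fun setT (X i).
Hypothesis identX : forall i A, measurable A -> P (X i @^-1` A) = P (X 0 @^-1` A).
Hypothesis indepX : forall (s : seq nat) (A : nat -> set T), uniq s ->
  (forall i, measurable (A i)) ->
  fine (P (\big[setI/setT]_(i <- s) (X i @^-1` A i))) =
  \prod_(i <- s) fine (P (X i @^-1` A i)).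

Let cyl (s : seq nat) (A : nat -> set T) : set W :=
  \big[setI/setT]_(i <- s) (X i @^-1` A i).

Let mpre i A : measurable A -> measurable (X i @^-1` A).
Proof. by move=> mA; rewrite -[X in measurable X]setTI; exact: mX. Qed.

Let mcyl s A : (forall i, measurable (A i)) -> measurable (cyl s A).
Proof.
by move=> mA; apply: bigsetI_measurable => i _; exact: mpre.
Qed.

(* [U] is independent of the family of the [X i] with [i] outside [s] *)
Definition indep_off d1 (V : measurableType d1) (U : W -> V) (s : seq nat) : Prop :=
  measurable_fun setT U /\
  forall (B : set V) (t : seq nat) (A : nat -> set T), measurable B -> uniq t ->
    {in t, forall i, i \notin s} -> (forall i, measurable (A i)) ->
    P (U @^-1` B `&` \big[setI/setT]_(i <- t) (X i @^-1` A i)) =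
    ((\prod_(i <- t) fine (P (X i @^-1` A i)))%:E * P (U @^-1` B))%E.

(** This is where the product formula [indepX] enters; all other independence is generated from a
    constant by [indep_off_pair] and [indep_off_comp]. *)
Lemma indep_off_cst d1 (V : measurableType d1) (v : V) : indep_off (fun=> v) [::].
Proof.
split => // B t A mB ut _ mA.
have [vB|vB] := pselect (B v).
  rewrite (_ : _ @^-1` _ = setT); last by apply/seteqP; split.
  rewrite setTI probability_setT mule1 -indepX// fineK//.
  by apply: fin_num_measure; exact: mcyl.
rewrite (_ : _ @^-1` _ = set0); last by apply/seteqP; split.
by rewrite set0I measure0 mule0.
Qed.

Lemma indep_off_comp d1 (V : measurableType d1) d2 (V' : measurableType d2)
    (g : V -> V') (U : W -> V) s :
  measurable_fun setT g -> indep_off U s -> indep_off (g \o U) s.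
Proof.
move=> mg [mU iU]; split; first exact: measurableT_comp.
move=> B t A mB ut ts mA; rewrite comp_preimage iU//.
by rewrite -[X in measurable X]setTI; exact: mg.
Qed.

Lemma indep_off_rect d1 (V : measurableType d1) (U : W -> V) s j B C :
  indep_off U s -> j \notin s -> measurable B -> measurable C ->
  P (U @^-1` B `&` X j @^-1` C) = (P (U @^-1` B) * P (X j @^-1` C))%E.
Proof.
move=> [mU iU] js mB mC.
have := iU B [:: j] (fun=> C) mB isT.
rewrite !big_seq1 => -> //; last by move=> i; rewrite inE => /eqP ->.
rewrite muleC fineK//; apply: fin_num_measure; exact: mpre.
Qed.

(** On a rectangle, the event on [X j] is moved into the cylinder, now over [j :: t] (the family
    [A']), where independence of [U] applies. [pair_law_restr] then passes from rectangles to every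
    measurable [Z]. *)
Lemma indep_off_pair d1 (V : measurableType d1) (U : W -> V) s j :
  indep_off U s -> j \notin s -> indep_off (fun w => (U w, X j w)) (j :: s).
Proof.
move=> iUs js; have [mU iU] := iUs.
split; first exact: measurable_fun_pair.
move=> Z t A mZ ut ts mA.
set c := \prod_(i <- t) _.
have c0 : 0 <= c by apply: prodr_ge0 => i _; exact: fine_ge0.
have jt : j \notin t by apply/negP => /ts; rewrite mem_head.
rewrite (pair_law_restr mU (mX j) (mcyl t mA) c0)//; last first.
  move=> B C mB mC.
  pose A' i := if i == j then C else A i.
  have mA' i : measurable (A' i) by rewrite /A'; case: ifP.
  have := iU B (j :: t) A' mB; rewrite /= jt ut => /(_ isT).
  have -> : \big[setI/setT]_(i <- (j :: t)) (X i @^-1` A' i) =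
            X j @^-1` C `&` cyl t A.
    rewrite big_cons {1}/A' eqxx; congr (_ `&` _).
    apply: eq_big_seq => i it; rewrite /A' ifF//; apply/negbTE.
    by apply: contraNneq jt => <-.
  rewrite setIA => ->//; last first.
    move=> i; rewrite inE => /predU1P[->//|/ts].
    by rewrite inE negb_or => /andP[].
  rewrite big_cons {1}/A' eqxx (_ : \prod_(i <- t) _ = c); last first.
    apply: eq_big_seq => i it; rewrite /A' ifF//; apply/negbTE.
    by apply: contraNneq jt => <-.
  rewrite mulrC EFinM -muleA (muleC (P (U @^-1` B))) fineK//.
  by apply: fin_num_measure; exact: mpre.
congr (_ * _)%E.
have := pair_law_restr (P := P) mU (mX j) measurableT ler01.
rewrite /= => /(_ _ Z mZ); rewrite mul1e setIT => -> //.
by move=> B C mB mC; rewrite setIT mul1e; exact: (indep_off_rect iUs js).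
Qed.

Lemma Rint_ident j (g : T -> R) : bmeas g -> \int[P]_w g (X j w) = \int[P]_w g (X 0 w).
Proof.
move=> bg.
pose Y i : {mfun W >-> T} := HB.pack (X i) (isMeasurableFun.Build _ _ _ _ _ (mX i)).
have intE i : \int[P]_w g (X i w) = \int[distribution P (Y i)]_x g x.
  rewrite /Rintegral (integral_distribution (X := Y i))//.
    by case: bg => mg _; apply/measurable_EFinP.
  exact: (bmeas_integrable P (bmeas_comp bg (mX i))).
rewrite !intE /Rintegral; congr fine; apply: eq_measure_integral => A mA _.
exact: identX.
Qed.

(** Equality of laws allows [X 0] as the fresh copy for every [j]. This is sound even when [0] lies
    in [s], since [w'] is a separate integration variable. *)
Lemma Rint_decouple d1 (V : measurableType d1) (U : W -> V) s j (f : V * T -> R) :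
  indep_off U s -> j \notin s -> bmeas f ->
  \int[P]_w f (U w, X j w) = \int[P]_w \int[P]_w' f (U w, X 0 w').
Proof.
move=> iU js bf; have [mU _] := iU.
rewrite (Rint_pair mU (mX j))//; last by move=> B C; exact: (indep_off_rect iU js).
apply: eq_Rintegral => w _; rewrite (Rint_ident j (g := fun y => f (U w, y)))//.
exact: bmeas_pair2.
Qed.

End iid.

(** * Normal distributions *)

Section gaussian.
Context {R : realType}.
Notation mu := (@lebesgue_measure R).
Implicit Types m s t u x : R.

(** The Radon-Nikodym derivative and the explicit density agree almost everywhere, because both
    integrate to [normal_prob] on every measurable set. *)
Lemma ge0_integral_normal_prob m s (f : R -> \bar R) :
  measurable_fun setT f -> (forall x, 0 <= f x)%E ->
  (\int[normal_prob m s]_x f x = \int[mu]_x (f x * (normal_pdf m s x)%:E))%E.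
Proof.
move=> mf f0.
have dom := normal_prob_dominates m s.
rewrite -(Radon_Nikodym_SigmaFinite.change_of_variables dom f0 measurableT mf).
apply: ae_eq_integral => //.
- apply: emeasurable_funM => //.
  exact: (measurable_int _ (Radon_Nikodym_SigmaFinite.f_integrable dom)).
- apply: emeasurable_funM => //; apply/measurable_EFinP.
  exact: measurable_normal_pdf.
apply: ae_eqe_mul2l => /=.
apply: integral_ae_eq => //=.
- exact: Radon_Nikodym_SigmaFinite.f_integrable.
- by apply/measurable_EFinP; exact: measurable_normal_pdf.
- by move=> E _ mE; rewrite -Radon_Nikodym_SigmaFinite.f_integral.
Qed.

Lemma normal_peakE s : 0 < s -> normal_peak s = s^-1 * normal_peak 1.
Proof.
move=> s0; rewrite /normal_peak -mulrnAr sqrtrM ?sqr_ge0// sqrtr_sqr gtr0_norm//.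
by rewrite expr1n mul1r invfM.
Qed.

Lemma normal_pdfP m s x : 0 < s -> normal_pdf m s x =
  s^-1 * normal_peak 1 * expR (- (x - m) ^+ 2 / (s ^+ 2 *+ 2)).
Proof. by move=> s0; rewrite normal_pdfE ?gt_eqF// normal_peakE. Qed.

(* the density of N(a, t^2) relative to N(m, s^2) has total mass 1 *)
Lemma Rint_normal_density m s a t (h : R -> R) : measurable_fun setT h ->
  (forall x, 0 <= h x) -> (forall x, h x * normal_pdf m s x = normal_pdf a t x) ->
  (normal_prob m s).-integrable setT (EFin \o h) /\ \int[normal_prob m s]_x h x = 1.
Proof.
move=> mh h0 hE.
have int1 : (\int[normal_prob m s]_x (h x)%:E = 1)%E.
  rewrite ge0_integral_normal_prob//; last exact/measurable_EFinP.
  by under eq_integral do rewrite -EFinM hE; rewrite integral_normal_pdf.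
split; last by rewrite /Rintegral int1.
apply/integrableP; split; first exact/measurable_EFinP.
by under eq_integral do rewrite /= ger0_norm//; rewrite int1 ltry.
Qed.

Section moments.
Variable s : R.
Hypothesis s0 : 0 < s.
Let g := normal_prob (0 : R) s.

(** The bound is pointwise against the density of twice the standard deviation, whose total mass is
    1. With [v = |x| / s] it reduces to [v^3 <= 16 expR (3 v^2 / 8)]; the remaining factor 2 of 32
    is the ratio of the two peaks. *)
Lemma normal_abs3_le : (\int[g]_x (`|x| ^+ 3)%:E <= (32 * s ^+ 3)%:E)%E.
Proof.
rewrite ge0_integral_normal_prob; last 2 first.
- by apply/measurable_EFinP/measurable_funX.
- by move=> x; rewrite lee_fin exprn_ge0.
apply: (@le_trans _ _ (\int[mu]_x ((32 * s ^+ 3)%:E * (normal_pdf 0 (2 * s) x)%:E))%E).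
  apply: ge0_le_integral => //.
  - by move=> x _; rewrite mule_ge0// lee_fin ?exprn_ge0// normal_pdf_ge0.
  - apply: emeasurable_funM; first by apply/measurable_EFinP/measurable_funX.
    by apply/measurable_EFinP; exact: measurable_normal_pdf.
  - apply: emeasurable_funM => //.
    by apply/measurable_EFinP; exact: measurable_normal_pdf.
  move=> x _; rewrite -!EFinM lee_fin !normal_pdfP ?mulr_gt0// subr0.
  pose v := `|x| / s.
  have v0 : 0 <= v by rewrite divr_ge0// ltW.
  have xE : `|x| = s * v by rewrite /v mulrC divfK// gt_eqF.
  have x2 : x ^+ 2 = s ^+ 2 * v ^+ 2 by rewrite -(real_normK (num_real x)) xE exprMn.
  rewrite xE x2.
  have sn0 : s != 0 by rewrite gt_eqF.
  have -> : - (s ^+ 2 * v ^+ 2) / (s ^+ 2 *+ 2) = - (v ^+ 2 / 2) by field.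
  (* The gap [3 v^2 / 8] between the exponents is split in halves, so that [1 + y <= expR y],
     squared, yields a term in [v^4] that can beat [v^3]. *)
  have -> : - (s ^+ 2 * v ^+ 2) / ((2 * s) ^+ 2 *+ 2) =
            - (v ^+ 2 / 2) + (3 * v ^+ 2 / 16 + 3 * v ^+ 2 / 16) by field.
  rewrite !expRD.
  set e := expR (- _); set b := expR (_ / 16).
  have e0 : 0 < e by exact: expR_gt0.
  have b1 : 1 + 3 * v ^+ 2 / 16 <= b by exact: expR_ge1Dx.
  have b2 : (1 + 3 * v ^+ 2 / 16) ^+ 2 <= b * b.
    by rewrite expr2 ler_pM// addr_ge0// divr_ge0// mulr_ge0// sqr_ge0.
  have v3 : v ^+ 3 <= 16 * (b * b).
    apply: (@le_trans _ _ (16 * (1 + 3 * v ^+ 2 / 16) ^+ 2)).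
      have := sqr_ge0 (v - 4/3); have := sqr_ge0 (v ^+ 2); have := sqr_ge0 v.
      (* Multiplied by 9/16 this is [9 v^4 / 16 - v^3 + 4 v^2 / 9], and the right-hand side expands
         to [16 + 6 v^2 + 9 v^4 / 16]. *)
      have : 0 <= v ^+ 2 * (v - 8/9) ^+ 2 by rewrite mulr_ge0// sqr_ge0.
      nra.
    by rewrite ler_pM2l.
  have p0 : 0 <= normal_peak (1 : R) by exact: normal_peak_ge0.
  have -> : (s * v) ^+ 3 * (s^-1 * normal_peak 1 * e) =
            (s ^+ 2 * normal_peak 1 * e) * v ^+ 3 by field.
  have -> : 32 * s ^+ 3 * ((2 * s)^-1 * normal_peak 1 * (e * (b * b))) =
            (s ^+ 2 * normal_peak 1 * e) * (16 * (b * b)) by field.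
  apply: ler_wpM2l => //; rewrite mulr_ge0 ?(ltW e0)// mulr_ge0// sqr_ge0//.
rewrite ge0_integralZl//.
- by rewrite integral_normal_pdf mule1.
- by apply/measurable_EFinP; exact: measurable_normal_pdf.
- by move=> x _; rewrite lee_fin normal_pdf_ge0.
- by rewrite lee_fin mulr_ge0// exprn_ge0// ltW.
Qed.

Lemma integrable_normal_abs3 : g.-integrable setT (fun x => (`|x| ^+ 3)%:E).
Proof.
apply/integrableP; split; first by apply/measurable_EFinP/measurable_funX.
under eq_integral do rewrite gee0_abs ?lee_fin ?exprn_ge0//.
exact: le_lt_trans normal_abs3_le (ltry _).
Qed.

Let int3 : g.-integrable setT (fun x => (1 + `|x| ^+ 3)%:E).
Proof.
exact: (integrableD measurableT (finite_measure_integrable_cst g 1 measurableT)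
  integrable_normal_abs3).
Qed.

Lemma integrable_normal_id : g.-integrable setT (fun x => x%:E).
Proof.
apply: le_integrable int3 => //; first exact/measurable_EFinP.
move=> x _; rewrite lee_fin [leRHS]ger0_norm ?addr_ge0// ?exprn_ge0//.
have := normr_ge0 x; set v := `|x| => v0.
have [v1|v1] := leP v 1; first by rewrite (le_trans v1)// lerDl exprn_ge0.
rewrite -subr_ge0 [X in 0 <= X](_ : _ = 1 + v * (v - 1) * (v + 1)); last by ring.
by rewrite addr_ge0// !mulr_ge0//; lra.
Qed.

Lemma integrable_normal_sqr : g.-integrable setT (fun x => (x ^+ 2)%:E).
Proof.
apply: le_integrable int3 => //; first by apply/measurable_EFinP/measurable_funX.
move=> x _; rewrite lee_fin [leRHS]ger0_norm ?addr_ge0// ?exprn_ge0//.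
rewrite normrX; have := normr_ge0 x; set v := `|x| => v0.
have [v1|v1] := leP v 1.
  rewrite (@le_trans _ _ 1)//; last by rewrite lerDl exprn_ge0.
  by rewrite expr_le1.
by rewrite (@le_trans _ _ (v ^+ 3))// ?ler_eXn2l// lerDr.
Qed.

Lemma Rint_normal_abs3_le : \int[g]_x (`|x| ^+ 3) <= 32 * s ^+ 3.
Proof.
rewrite -lee_fin /Rintegral fineK; first exact: normal_abs3_le.
exact: integrable_fin_num integrable_normal_abs3.
Qed.

(* Comparing N(a, s^2) with N(0, s^2) through [1 + y <= expR y] gives
   [a * e <= a^2 / 2] for every [a], hence [e = 0], where [e] is the mean. *)
Lemma Rint_normal_id : \int[g]_x x = 0.
Proof.
pose e := \int[g]_x x; rewrite -/e.
have sn0 : s != 0 by rewrite gt_eqF.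
have key a : a * e <= a ^+ 2 / 2.
  pose h x := expR (a / s ^+ 2 * x - a ^+ 2 / (s ^+ 2 * 2)).
  have mh : measurable_fun setT h.
    apply: measurableT_comp => //; apply: measurable_funB => //.
  have [inth h1] : g.-integrable setT (EFin \o h) /\ \int[g]_x h x = 1.
    apply: (@Rint_normal_density 0 s a s) => //.
      by move=> x; exact: expR_ge0.
    move=> x; rewrite !normal_pdfP// /h. rewrite mulrCA -expRD; congr (_ * expR _).
    by field.
  have : \int[g]_x (a / s ^+ 2 * x + (1 - a ^+ 2 / (s ^+ 2 * 2))) <= \int[g]_x h x.
    apply: le_Rintegral => //.
      exact: (integrableD measurableT (integrableZl measurableT _ integrable_normal_id)
        (finite_measure_integrable_cst g _ measurableT)).
    move=> x _; rewrite /h (le_trans _ (expR_ge1Dx _))//.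
    by rewrite addrCA addrA addrC.
  rewrite h1 RintegralD//; last 2 first.
  - exact: (integrableZl measurableT _ integrable_normal_id).
  - exact: finite_measure_integrable_cst.
  rewrite RintegralZl//; last exact: integrable_normal_id.
  rewrite -/e Rint_cst -[leRHS]addr0 => le1.
  have : (a / s ^+ 2 * e - a ^+ 2 / (s ^+ 2 * 2)) * s ^+ 2 <= 0.
    by rewrite pmulr_lle0 ?exprn_gt0//; lra.
  by rewrite (_ : _ * _ = a * e - a ^+ 2 / 2); [lra|field].
(* The choice [a = e] gives [e^2 <= e^2 / 2]. *)
have := key e; have := sqr_ge0 e; rewrite -expr2 => e0 e1.
by apply/eqP; rewrite -sqrf_eq0 eq_le e0 andbT; lra.
Qed.

(* Same comparison with N(0, (s/b)^2): [(b - 1) (b (b + 1) q - 2) >= 0] for every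
   [b > 0], where [q] is the second moment over [s^2]; hence [q = 1]. *)
Lemma Rint_normal_sqr : \int[g]_x (x ^+ 2) = s ^+ 2.
Proof.
pose e := \int[g]_x (x ^+ 2); rewrite -/e.
have sn0 : s != 0 by rewrite gt_eqF.
pose q := e / s ^+ 2.
have eE : e = q * s ^+ 2 by rewrite /q divfK// expf_neq0.
have q0 : 0 <= q.
  by rewrite divr_ge0 ?sqr_ge0//; apply: Rintegral_ge0 => x _; exact: sqr_ge0.
have key b : 0 < b -> 2 * (b - 1) <= (b - 1) * (b * (b + 1) * q).
  move=> b0.
  pose h x := b * expR (- ((b ^+ 2 - 1) / (s ^+ 2 * 2)) * x ^+ 2).
  have mh : measurable_fun setT h.
    apply: measurable_funM => //; apply: measurableT_comp => //.
    exact: measurable_funM.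
  have bn0 : b != 0 by rewrite gt_eqF.
  have [inth h1] : g.-integrable setT (EFin \o h) /\ \int[g]_x h x = 1.
    apply: (@Rint_normal_density 0 s 0 (s / b)) => //.
      by move=> x; rewrite mulr_ge0// ?expR_ge0// ltW.
    move=> x; rewrite !normal_pdfP ?divr_gt0// /h.
    rewrite [LHS](_ : _ = ((s / b)^-1 * normal_peak 1) *
      (expR (- ((b ^+ 2 - 1) / (s ^+ 2 * 2)) * x ^+ 2) *
       expR (- (x - 0) ^+ 2 / (s ^+ 2 *+ 2)))); last by field; rewrite sn0 bn0.
    by rewrite -expRD; congr (_ * expR _); field; rewrite sn0 bn0.
  have : \int[g]_x (- (b * ((b ^+ 2 - 1) / (s ^+ 2 * 2))) * x ^+ 2 + b) <= \int[g]_x h x.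
    apply: le_Rintegral => //.
      exact: (integrableD measurableT (integrableZl measurableT _ integrable_normal_sqr)
        (finite_measure_integrable_cst g _ measurableT)).
    move=> x _; rewrite /h.
    rewrite [leLHS](_ : _ = b * (1 + - ((b ^+ 2 - 1) / (s ^+ 2 * 2)) * x ^+ 2)); last by ring.
    by rewrite ler_pM2l// expR_ge1Dx.
  rewrite h1 RintegralD//; last 2 first.
  - exact: (integrableZl measurableT _ integrable_normal_sqr).
  - exact: finite_measure_integrable_cst.
  rewrite RintegralZl//; last exact: integrable_normal_sqr.
  rewrite -/e Rint_cst eE.
  rewrite (_ : - _ * _ = - ((b - 1) * (b * (b + 1) * q)) / 2); last by field.
  lra.
suff qE : q = 1 by rewrite eE qE mul1r.
apply/eqP; rewrite eq_le; apply/andP; split; rewrite leNgt; apply/negP => q1.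
(* For this [b < 1], dividing by [b - 1] reverses the inequality, which becomes
   [(3 q - 1) (q - 1) <= 0]; that fails for [q > 1]. *)
- have b0 : 0 < (q + 1) / (2 * q) by rewrite divr_gt0//; lra.
  have := key _ b0; set b := (q + 1) / (2 * q) in b0 *.
  have bq : b * (2 * q) = q + 1 by rewrite /b divfK//; apply/eqP; lra.
  have b1 : b - 1 < 0 by nra.
  rewrite mulrC ler_nM2l// => le2.
  nra.
(* For this [b > 1] the inequality simplifies to [q >= 1]. The denominator [1 + q] stays positive
   also at [q = 0]. *)
- have b0 : 0 < 2 / (1 + q) by rewrite divr_gt0//; lra.
  have := key _ b0; set b := 2 / (1 + q) in b0 *.
  have bq : b * (1 + q) = 2 by rewrite /b divfK//; apply/eqP; lra.
  have b1 : 0 < b - 1 by nra.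
  rewrite mulrC ler_pM2l// => le2.
  nra.
Qed.

End moments.
End gaussian.

(** * Convolution of normal laws *)

Section gaussian_convolution.
Context {R : realType}.
Notation mu := (@lebesgue_measure R).
Implicit Types (m s t u x : R) (f : R -> R).

Lemma ge0_integral_normal_probE m s f : measurable_fun setT f ->
  (forall x, 0 <= f x) ->
  (\int[normal_prob m s]_x (f x)%:E = \int[mu]_x (f x * normal_pdf m s x)%:E)%E.
Proof.
move=> mf f0; rewrite (@ge0_integral_normal_prob _ _ _ (fun x => (f x)%:E))//.
exact/measurable_EFinP.
Qed.

(** Translation by [a] as a change of variables on the whole line; that substitution rule asks for a
    continuous integrand, hence the hypothesis on [f]. *)
Lemma integral_normal_prob_shift a t f : 0 < t -> continuous f ->
  (forall x, 0 <= f x) ->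
  (\int[normal_prob 0 t]_x (f (a + x))%:E = \int[normal_prob a t]_x (f x)%:E)%E.
Proof.
move=> t0 cf f0.
have mf : measurable_fun setT f by exact: continuous_measurable_fun.
have mfa : measurable_fun setT (fun x => f (a + x)).
  by apply: measurableT_comp => //; exact: measurable_funD.
rewrite (ge0_integral_normal_probE 0 t mfa)//.
rewrite [in RHS](ge0_integral_normal_probE a t mf); last exact: f0.
have dF x : is_derive (x : R^o) 1 (fun y : R^o => y + a : R^o) 1.
  by rewrite -[X in is_derive _ _ _ X]addr0; apply: is_deriveD.
have F'E : (fun y : R^o => y + a : R^o)^`()%classic = cst 1.
  by apply/funext => x; rewrite derive1E; exact: derive_val.
rewrite (@increasing_ge0_integration_by_substitutionT _ (fun y : R^o => y + a)
  (fun x => f x * normal_pdf a t x)); first last.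
- by move=> x; rewrite mulr_ge0// normal_pdf_ge0.
- move=> x; apply: continuousM; first exact: cf.
  by apply: continuous_normal_pdf; rewrite gt_eqF.
- exact: cvg_addrr.
- exact: cvg_addrr_Ny.
- by move=> x; have := dF x; case.
- by rewrite F'E; exact: is_cvg_cst.
- by rewrite F'E; exact: is_cvg_cst.
- by rewrite F'E => ?; exact: cvg_cst.
- by move=> x y xy; rewrite ltrD2r.
apply: eq_integral => x _; rewrite F'E /= !fctE mulr1 (addrC x) !normal_pdfP//.
by rewrite subr0 addrAC subrr add0r.
Qed.

Lemma integral_normal_prob_conv s t u f : 0 < s -> 0 < t -> 0 < u ->
  u ^+ 2 = s ^+ 2 + t ^+ 2 -> continuous f -> (forall x, 0 <= f x) ->
  (\int[normal_prob 0 s]_a \int[normal_prob 0 t]_b (f (a + b))%:E =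
   \int[normal_prob 0 u]_x (f x)%:E)%E.
Proof.
move=> s0 t0 u0 uE cf f0.
have mf : measurable_fun setT f by exact: continuous_measurable_fun.
transitivity (\int[normal_prob 0 s]_a \int[normal_prob a t]_x (f x)%:E)%E.
  by apply: eq_integral => a _; exact: integral_normal_prob_shift.
(* [f] at the sum [w = a + b], times the joint density of [a] and [w]; Tonelli then integrates over
   [a] first. *)
pose K (z : R * R) : \bar R :=
  ((f z.2)%:E * (normal_pdf 0 t (z.2 - z.1))%:E * (normal_pdf 0 s z.1)%:E)%E.
have mK : measurable_fun setT K.
  apply: emeasurable_funM; [apply: emeasurable_funM|]; apply/measurable_EFinP.
  - by apply: (measurableT_comp mf); exact: measurable_snd.
  - apply: (measurableT_comp (measurable_normal_pdf 0 t)).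
    by apply: measurable_funB; [exact: measurable_snd|exact: measurable_fst].
  - by apply: (measurableT_comp (measurable_normal_pdf 0 s)); exact: measurable_fst.
have K0 z : (0 <= K z)%E by rewrite /K !mule_ge0 ?lee_fin// normal_pdf_ge0.
have pdf_shift a w : normal_pdf a t w = normal_pdf 0 t (w - a).
  by rewrite !normal_pdfP// subr0.
have innerE a : (\int[normal_prob a t]_x (f x)%:E * (normal_pdf 0 s a)%:E =
    \int[mu]_w K (a, w))%E.
  rewrite (ge0_integral_normal_probE a t mf)//; apply/esym.
  transitivity (\int[mu]_w ((f w * normal_pdf a t w)%:E * (normal_pdf 0 s a)%:E))%E.
    by apply: eq_integral => w _; rewrite /K /= -pdf_shift EFinM.
  apply: ge0_integralZr => //.
  - apply/measurable_EFinP; apply: measurable_funM => //.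
    exact: measurable_normal_pdf.
  - by move=> x _; rewrite lee_fin mulr_ge0// normal_pdf_ge0.
  - by rewrite lee_fin normal_pdf_ge0.
rewrite [LHS]ge0_integral_normal_prob; first last.
- by move=> a; apply: integral_ge0 => x _; rewrite lee_fin.
- rewrite (_ : (fun a => _) = fun a =>
    (\int[mu]_w ((f w)%:E * (normal_pdf 0 t (w - a))%:E))%E); last first.
    apply/funext => a; rewrite (ge0_integral_normal_probE a t mf); last exact: f0.
    by apply: eq_integral => w _; rewrite pdf_shift.
  apply: (measurable_fun_fubini_tonelli_F (m2 := mu)
    (fun z : R * R => (f z.2)%:E * (normal_pdf 0 t (z.2 - z.1))%:E)%E).
    apply: emeasurable_funM; apply/measurable_EFinP.
      by apply: (measurableT_comp mf); exact: measurable_snd.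
    apply: (measurableT_comp (measurable_normal_pdf 0 t)).
    by apply: measurable_funB; [exact: measurable_snd|exact: measurable_fst].
  by move=> z; rewrite mule_ge0 ?lee_fin// normal_pdf_ge0.
transitivity (\int[mu]_a \int[mu]_w K (a, w))%E.
  by apply: eq_integral => a _; exact: innerE.
transitivity (\int[mu]_w \int[mu]_a K (a, w))%E.
  exact: (fubini_tonelli (m1 := mu) (m2 := mu) K mK K0).
rewrite (ge0_integral_normal_probE 0 u mf)//.
apply: eq_integral => w _.
(* Completing the square in [a]: given that the sum equals [w], the first summand is normal with
   mean [m] and standard deviation [v]. Its density integrates to 1, which leaves the density of the
   sum. *)
pose v := s * t / u; pose m := s ^+ 2 * w / u ^+ 2.
have v0 : 0 < v by rewrite divr_gt0// mulr_gt0.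
transitivity (\int[mu]_a (((f w)%:E * (normal_pdf 0 u w)%:E) * (normal_pdf m v a)%:E))%E.
  apply: eq_integral => a _; rewrite /K /= -!EFinM; congr EFin.
  rewrite -!mulrA; congr (_ * _); rewrite !normal_pdfP// !subr0.
  have sn0 : s != 0 by rewrite gt_eqF.
  have tn0 : t != 0 by rewrite gt_eqF.
  have un0 : u != 0 by rewrite gt_eqF.
  have Un0 : s ^+ 2 + t ^+ 2 != 0 by rewrite -uE expf_neq0.
  have splitE (p q k l y z : R) : p * k * expR y * (q * l * expR z) =
      p * q * (k * l) * expR (y + z) by rewrite expRD; ring.
  rewrite !splitE; congr (_ * _ * expR _); first by rewrite /v; field; rewrite sn0 tn0 un0.
  rewrite /m /v expr_div_n uE; field.
  by rewrite sn0 tn0 Un0.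
rewrite ge0_integralZl//.
- by rewrite integral_normal_pdf mule1.
- by apply/measurable_EFinP; exact: measurable_normal_pdf.
- by move=> x _; rewrite lee_fin normal_pdf_ge0.
- by rewrite mule_ge0// lee_fin// normal_pdf_ge0.
Qed.

End gaussian_convolution.
(** * Smooth test functions *)

Section smooth_step.
Context {R : realType}.
Implicit Types (x h t C : R) (f : R -> R).

(** A derivative-free encoding: [a] and [b] stand for the first derivative and half the second one
    at [x], and only [C] has to be uniform in [x]. *)
Definition taylor3 C f : Prop := forall x, exists a b,
  forall h, `|f (x + h) - f x - a * h - b * h ^+ 2| <= C * `|h| ^+ 3.

Lemma taylor3_lin C1 C2 f1 f2 c : taylor3 C1 f1 -> taylor3 C2 f2 ->
  taylor3 (C1 + `|c| * C2) (fun x => f1 x + c * f2 x).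
Proof.
move=> T1 T2 x; have [a1 [b1 h1]] := T1 x; have [a2 [b2 h2]] := T2 x.
exists (a1 + c * a2), (b1 + c * b2) => h.
rewrite (_ : _ - _ = (f1 (x + h) - f1 x - a1 * h - b1 * h ^+ 2) +
   c * (f2 (x + h) - f2 x - a2 * h - b2 * h ^+ 2)); last by ring.
rewrite (le_trans (ler_normD _ _))// mulrDl lerD// normrM -mulrA.
by rewrite ler_wpM2l.
Qed.

Lemma taylor3_affine C f c d : taylor3 C f ->
  taylor3 (C * `|c| ^+ 3) (fun x => f (d + c * x)).
Proof.
move=> Tf x; have [a [b Hab]] := Tf (d + c * x).
exists (a * c), (b * c ^+ 2) => h.
rewrite mulrDr addrA -(mulrA a) -(mulrA b) -exprMn -(mulrA C) -exprMn -normrM.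
exact: Hab.
Qed.

Definition cube_pos x : R := Num.max x 0 ^+ 3.

(** The second derivative [6 max(x, 0)] is 6-Lipschitz, so the constant is 6/3! = 1. If [x] and
    [x + h] lie on the same side of 0 the remainder is exactly [h^3] or 0; otherwise a cube between
    0 and [h^3] intervenes. *)
Lemma taylor3_cube_pos : taylor3 1 cube_pos.
Proof.
move=> x; exists (3 * Num.max x 0 ^+ 2), (3 * Num.max x 0) => h.
rewrite mul1r /cube_pos -normrX.
have [x0|x0] := leP 0 x; have [y0|y0] := leP 0 (x + h).
- rewrite (_ : _ - _ = h ^+ 3); last by ring.
  by [].
- have h0 : h < 0 by lra.
  rewrite (ltr0_norm (_ : h ^+ 3 < 0)); last by rewrite exprn_odd_lt0.
  rewrite (_ : _ - _ = h ^+ 3 - (x + h) ^+ 3); last by ring.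
  have : (x + h) ^+ 3 <= 0 by rewrite exprn_odd_le0// ltW.
  have : 0 <= (- (x + h)) ^+ 3 by rewrite exprn_ge0//; lra.
  have : (- (x + h)) ^+ 3 <= (- h) ^+ 3.
    by rewrite lerXn2r ?nnegrE//; lra.
  have cubeN (z : R) : (- z) ^+ 3 = - z ^+ 3 by ring.
  by rewrite !cubeN ler_norml => ? ? ?; lra.
- have h0 : 0 < h by lra.
  rewrite (ger0_norm (_ : 0 <= h ^+ 3)); last by rewrite exprn_ge0// ltW.
  rewrite (_ : _ - _ = (x + h) ^+ 3); last by ring.
  by rewrite ger0_norm ?exprn_ge0// lerXn2r ?nnegrE//; lra.
- by rewrite (_ : _ - _ = 0); [rewrite normr0|ring].
Qed.

Lemma continuous_cube_pos : continuous cube_pos.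
Proof.
move=> x; apply: (continuous_comp (f := fun y : R => Num.max y 0)
  (g := fun y : R => y ^+ 3)); last exact: exprn_continuous.
by apply: continuous_max => //; exact: cvg_cst.
Qed.

(* the distribution function of a sum of three independent uniforms on [0, 1] *)
Definition smooth_step x : R :=
  (cube_pos x - 3 * cube_pos (x - 1) + 3 * cube_pos (x - 2) - cube_pos (x - 3)) / 6.

Lemma smooth_step_eq0 x : x <= 0 -> smooth_step x = 0.
Proof.
by move=> x0; rewrite /smooth_step /cube_pos !max_r; [ring|lra..].
Qed.

Lemma smooth_step_eq1 x : 3 <= x -> smooth_step x = 1.
Proof.
by move=> x0; rewrite /smooth_step /cube_pos !max_l; [field|lra..].
Qed.

Lemma smooth_step_itv x : 0 <= smooth_step x <= 1.
Proof.
have [x0|x0] := leP x 0; first by rewrite smooth_step_eq0// lexx ler01.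
have [x3|x3] := leP 3 x; first by rewrite smooth_step_eq1// lexx ler01.
rewrite /smooth_step /cube_pos (max_r (_ : x - 3 <= 0)) ?(max_l (_ : 0 <= x)); [|lra..].
have [x1|x1] := leP x 1.
  rewrite !max_r; [|lra..]; rewrite expr0n/= !mulr0 !subr0 addr0.
  have : 0 <= x ^+ 3 by rewrite exprn_ge0// ltW.
  have : x ^+ 3 <= 1 by rewrite exprn_ile1// ltW.
  lra.
rewrite (max_l (_ : 0 <= x - 1)); last lra.
have [x2|x2] := leP x 2.
  rewrite max_r; last lra.
  pose v := x - 1; have -> : x = v + 1 by rewrite /v; ring.
  have v0 : 0 <= v by rewrite /v; lra.
  have v1 : v <= 1 by rewrite /v; lra.
  have v3 : 0 <= v ^+ 3 by rewrite exprn_ge0.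
  have v2 : 0 <= v ^+ 2 by rewrite exprn_ge0.
  have v32 : v ^+ 3 <= v ^+ 2 by rewrite exprS ler_piMl.
  have v21 : v ^+ 2 <= v by rewrite expr2 ler_piMl.
  have -> : (v + 1) ^+ 3 = v ^+ 3 + 3 * v ^+ 2 + 3 * v + 1 by ring.
  (* Six times the middle piece is [1 + 3 v + 3 v^2 - 2 v^3], and 6 minus it equals
     [(1 - v)^2 (1 + 2 v) + (4 - 3 v)]. *)
  have : 0 <= (1 - v) ^+ 2 * (1 + 2 * v) by rewrite mulr_ge0 ?sqr_ge0//; lra.
  have -> : (1 - v) ^+ 2 * (1 + 2 * v) = 1 - 3 * v ^+ 2 + 2 * v ^+ 3 by ring.
  rewrite addrK expr0n/=; lra.
rewrite max_l; last lra.
(* The symmetry of the three uniforms about 1/2 makes the last piece [1 - v^3 / 6]. *)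
pose v := 3 - x; have -> : x = 3 - v by rewrite /v; ring.
have v0 : 0 <= v by rewrite /v; lra.
have v1 : v <= 1 by rewrite /v; lra.
have v3 : 0 <= v ^+ 3 by rewrite exprn_ge0.
have v31 : v ^+ 3 <= 1 by rewrite exprn_ile1.
rewrite (_ : _ / 6 = (6 - v ^+ 3) / 6); last by field.
lra.
Qed.

Lemma continuous_smooth_step : continuous smooth_step.
Proof.
have cc c : continuous (fun x : R => cube_pos (x - c)).
  move=> x; apply: (continuous_comp (f := fun x : R => x - c));
    last exact: continuous_cube_pos.
  by apply: cvgB; [exact: cvg_id|exact: cvg_cst].
move=> x; rewrite /smooth_step.
apply: cvgM; last exact: cvg_cst.
apply: cvgB; last exact: cc.
apply: cvgD; first apply: cvgB; first exact: continuous_cube_pos.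
  by apply: cvgM; [exact: cvg_cst|exact: cc].
by apply: cvgM; [exact: cvg_cst|exact: cc].
Qed.

Lemma taylor3_smooth_step : exists C, taylor3 C smooth_step.
Proof.
have cc c : taylor3 1 (fun x : R => cube_pos (x - c)).
  have := taylor3_affine 1 (- c) taylor3_cube_pos.
  rewrite normr1 expr1n mulr1; congr taylor3; apply/funext => x.
  by rewrite mul1r addrC.
have c0 : taylor3 0 (fun=> 0 : R).
  by move=> x; exists 0, 0 => h; rewrite !mul0r !subr0 normr0.
have := taylor3_lin (- 6^-1) (taylor3_lin (3 / 6) (taylor3_lin (- 3 / 6)
  (taylor3_lin 6^-1 c0 taylor3_cube_pos) (cc 1)) (cc 2)) (cc 3).
set C := (X in taylor3 X) => T; exists C; move: T; congr taylor3.
by apply/funext => x; rewrite /smooth_step; field.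
Qed.

(** The argument is [3 + (t - x) / delta], put in the form [d + c * x] of [taylor3_affine]; the
    descent from 1 to 0 takes place on [[t, t + 3 delta]]. *)
Definition step_down t (delta : R) x : R := smooth_step (t / delta + 3 + (- delta^-1) * x).

Section step_down.
Variables (t delta : R).
Hypothesis delta0 : 0 < delta.

Lemma step_down_itv x : 0 <= step_down t delta x <= 1.
Proof. exact: smooth_step_itv. Qed.

Lemma step_down_eq1 x : x <= t -> step_down t delta x = 1.
Proof.
move=> xt; apply: smooth_step_eq1.
rewrite addrAC lerDr mulNr subr_ge0 mulrC ler_wpM2r// invr_ge0 ltW//.
Qed.

Lemma step_down_eq0 x : t + 3 * delta <= x -> step_down t delta x = 0.
Proof.
move=> xt; apply: smooth_step_eq0.
rewrite mulNr subr_le0 (mulrC delta^-1) ler_pdivlMr// mulrDl divfK//.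
by rewrite gt_eqF.
Qed.

Lemma continuous_step_down : continuous (step_down t delta).
Proof.
move=> x; rewrite /step_down.
apply: (continuous_comp 
  (f := fun x : R => t / delta + 3 + (- delta^-1) * x));
  last exact: continuous_smooth_step.
apply: cvgD; first exact: cvg_cst.
by apply: cvgM; [exact: cvg_cst|exact: cvg_id].
Qed.

Lemma taylor3_step_down : exists C, taylor3 C (step_down t delta).
Proof.
have [C TC] := taylor3_smooth_step; eexists.
exact: (taylor3_affine (- delta^-1) (t / delta + 3) TC).
Qed.

End step_down.
End smooth_step.

(** * Lindeberg's method *)

Section shift_operator.
Context {R : realType} d (W : measurableType d) (P : probability W R) (Y : W -> R).
Hypothesis mY : measurable_fun setT Y.
Implicit Types (f g : R -> R) (x : R).

Definition shift_op f x : R := \int[P]_w f (x + Y w).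

Let bmeas2 f : bmeas f -> bmeas (fun z : R * W => f (z.1 + Y z.2)).
Proof.
move=> bf; apply: (bmeas_comp (h := fun z : R * W => z.1 + Y z.2) bf).
apply: measurable_funD; first exact: measurable_fst.
by apply: (measurableT_comp mY); exact: measurable_snd.
Qed.

Let bmeas1 f x : bmeas f -> bmeas (fun w => f (x + Y w)).
Proof.
move=> bf; apply: (bmeas_comp (h := fun w => x + Y w) bf).
exact: measurable_funD.
Qed.

Lemma bmeas_shift_op f : bmeas f -> bmeas (shift_op f).
(* Fubini is stated for a product of two probabilities; a Dirac mass fills the first factor, where
   only measurability in [x] is wanted. *)
Proof. by move=> /bmeas2; exact: (bmeas_Rint2 (dirac (0 : R)) P). Qed.

Lemma bmeas_iter_shift_op n f : bmeas f -> bmeas (iter n shift_op f).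
Proof. by move=> bf; elim: n => //= n; exact: bmeas_shift_op. Qed.

Lemma shift_op_close eps f g : bmeas f -> bmeas g ->
  (forall x, `|f x - g x| <= eps) ->
  forall x, `|shift_op f x - shift_op g x| <= eps.
Proof.
move=> bf bg fg x; rewrite /shift_op -RintB; [|exact: bmeas1..].
by apply: Rint_norm_le => //; apply: bmeasB; exact: bmeas1.
Qed.

Lemma iter_shift_op_close n eps f g : bmeas f -> bmeas g ->
  (forall x, `|f x - g x| <= eps) ->
  forall x, `|iter n shift_op f x - iter n shift_op g x| <= eps.
Proof.
move=> bf bg fg; elim: n => //= n IH.
by apply: shift_op_close IH; exact: bmeas_iter_shift_op.
Qed.

Hypotheses (iY : P.-integrable setT (fun w => (Y w)%:E))
  (iY2 : P.-integrable setT (fun w => (Y w ^+ 2)%:E))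
  (iY3 : P.-integrable setT (fun w => (`|Y w| ^+ 3)%:E))
  (Y0 : \int[P]_w Y w = 0).

(** The Taylor bound is integrated: the linear term vanishes because [Y] is centred, and the
    quadratic one sees [Y] only through its second moment, so it cancels between two variables of
    equal variance. *)
Lemma shift_op_expansion C f x a b : bmeas f ->
  (forall h, `|f (x + h) - f x - a * h - b * h ^+ 2| <= C * `|h| ^+ 3) ->
  `|shift_op f x - f x - b * \int[P]_w (Y w ^+ 2)| <= C * \int[P]_w (`|Y w| ^+ 3).
Proof.
move=> bf Tf.
have if1 : P.-integrable setT (EFin \o (fun w => f (x + Y w) - f x)).
  by apply: bmeas_integrable; apply: bmeasB; [exact: bmeas1|exact: bmeas_cst].
have iaY : P.-integrable setT (EFin \o (fun w => a * Y w)).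
  exact: (integrableZl measurableT a iY).
have ibY : P.-integrable setT (EFin \o (fun w => b * Y w ^+ 2)).
  exact: (integrableZl measurableT b iY2).
have if2 : P.-integrable setT (EFin \o (fun w => f (x + Y w) - f x - a * Y w)).
  exact: (integrableB measurableT if1 iaY).
have -> : shift_op f x - f x - b * \int[P]_w (Y w ^+ 2) =
    \int[P]_w (f (x + Y w) - f x - a * Y w - b * Y w ^+ 2).
  rewrite (@RintegralB _ _ _ P _ (fun w => f (x + Y w) - f x - a * Y w))//.
  rewrite (@RintegralB _ _ _ P _ (fun w => f (x + Y w) - f x))//.
  rewrite RintB; [|exact: bmeas1|exact: bmeas_cst].
  by rewrite !RintegralZl// Y0 mulr0 subr0 Rint_cst.
rewrite -RintegralZl//; apply: le_trans (le_normr_Rintegral measurableT _) _.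
  exact: (integrableB measurableT if2 ibY).
apply: le_Rintegral => //.
  have := integrable_norm (integrableB measurableT if2 ibY).
  exact.
exact: (integrableZl measurableT C iY3).
Qed.

End shift_operator.

Section lindeberg.
Context {R : realType}.
Context d1 (W1 : measurableType d1) (P1 : probability W1 R) (Y1 : W1 -> R).
Context d2 (W2 : measurableType d2) (P2 : probability W2 R) (Y2 : W2 -> R).
Hypotheses (mY1 : measurable_fun setT Y1) (mY2 : measurable_fun setT Y2).
Implicit Types (f g : R -> R) (x : R).

Notation A1 := (shift_op P1 Y1).
Notation A2 := (shift_op P2 Y2).

Lemma shift_op_comm f : bmeas f -> A1 (A2 f) = A2 (A1 f).
Proof.
move=> bf; apply/funext => x; rewrite /shift_op.
rewrite (@Rint_swap _ _ _ _ _ P1 P2 (fun z => f (x + Y1 z.1 + Y2 z.2))).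
  by apply: eq_Rintegral => w _; apply: eq_Rintegral => w' _; rewrite addrAC.
apply: (bmeas_comp (h := fun z : W1 * W2 => x + Y1 z.1 + Y2 z.2) bf).
apply: measurable_funD; last by apply: (measurableT_comp mY2); exact: measurable_snd.
by apply: measurable_funD => //; apply: (measurableT_comp mY1); exact: measurable_fst.
Qed.

Lemma shift_op_iter_comm n f : bmeas f -> A1 (iter n A2 f) = iter n A2 (A1 f).
Proof.
move=> bf; elim: n => //= n <-; apply: shift_op_comm.
exact: bmeas_iter_shift_op.
Qed.

(** Telescoping with [A1 A2^n f = A2^n A1 f]: the difference [A1 f - A2 f] is formed at [f] and then
    pushed through the contraction [A2^n]. *)
Lemma iter_shift_op_swap eps f : bmeas f -> (forall x, `|A1 f x - A2 f x| <= eps) ->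
  forall n x, `|iter n A1 f x - iter n A2 f x| <= n%:R * eps.
Proof.
move=> bf f12; elim=> [|n IH] x; first by rewrite subrr normr0 mul0r.
rewrite [X in `|X|](_ : _ = (iter n.+1 A1 f x - A1 (iter n A2 f) x) +
  (A1 (iter n A2 f) x - iter n.+1 A2 f x)); last by ring.
rewrite (le_trans (ler_normD _ _))// -natr1 mulrDl mul1r lerD//=.
  by apply: (shift_op_close P1 mY1 _ _ IH); exact: bmeas_iter_shift_op.
rewrite shift_op_iter_comm// -iterS iterSr.
by apply: (iter_shift_op_close P2 mY2 _ _ _ f12); exact: bmeas_shift_op.
Qed.

Hypotheses (iY1 : P1.-integrable setT (fun w => (Y1 w)%:E))
  (iY12 : P1.-integrable setT (fun w => (Y1 w ^+ 2)%:E))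
  (iY13 : P1.-integrable setT (fun w => (`|Y1 w| ^+ 3)%:E))
  (iY2 : P2.-integrable setT (fun w => (Y2 w)%:E))
  (iY22 : P2.-integrable setT (fun w => (Y2 w ^+ 2)%:E))
  (iY23 : P2.-integrable setT (fun w => (`|Y2 w| ^+ 3)%:E)).
Hypotheses (Y10 : \int[P1]_w Y1 w = 0) (Y20 : \int[P2]_w Y2 w = 0)
  (Y1Y2 : \int[P1]_w (Y1 w ^+ 2) = \int[P2]_w (Y2 w ^+ 2)).

Lemma lindeberg_swap C f n x : bmeas f -> taylor3 C f ->
  `|iter n A1 f x - iter n A2 f x| <=
  n%:R * (C * (\int[P1]_w (`|Y1 w| ^+ 3) + \int[P2]_w (`|Y2 w| ^+ 3))).
Proof.
move=> bf Tf; apply: iter_shift_op_swap => // y.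
have [a [b Tab]] := Tf y.
have := shift_op_expansion mY1 iY1 iY12 iY13 Y10 bf Tab.
have := shift_op_expansion mY2 iY2 iY22 iY23 Y20 bf Tab.
rewrite Y1Y2 mulrDr => h2 h1.
rewrite (_ : A1 f y - A2 f y =
  (A1 f y - f y - b * \int[P2]_w (Y2 w ^+ 2)) -
  (A2 f y - f y - b * \int[P2]_w (Y2 w ^+ 2))); last by ring.
by rewrite (le_trans (ler_normB _ _))// lerD.
Qed.

End lindeberg.

Section iterated_normal.
Context {R : realType}.

Lemma shift_op_normal_prob s t u (f : R -> R) x : 0 < s -> 0 < t -> 0 < u ->
  u ^+ 2 = s ^+ 2 + t ^+ 2 -> continuous f -> (forall y, 0 <= f y) -> bmeas f ->
  \int[normal_prob 0 s]_a \int[normal_prob 0 t]_b f (x + a + b) =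
  \int[normal_prob 0 u]_y f (x + y).
Proof.
move=> s0 t0 u0 uE cf f0 bf.
have cfx : continuous (fun y => f (x + y)).
  move=> y; apply: (continuous_comp (f := fun z => x + z)); last exact: cf.
  by apply: cvgD; [exact: cvg_cst|exact: cvg_id].
have convE := integral_normal_prob_conv s0 t0 u0 uE cfx (fun y => f0 (x + y)).
apply: (etrans (congr1 fine _) (congr1 fine convE)); apply: eq_integral => a _.
have bfa : bmeas (fun b : measurableTypeR R => f (x + a + b)).
  apply: (bmeas_comp (h := fun b => x + a + b) bf).
  by apply: measurable_funD.
under [in RHS]eq_integral => b _ do rewrite addrA.
apply: fineK.
exact: (integrable_fin_num measurableT (bmeas_integrable (normal_prob 0 _) bfa)).
Qed.

(** The count starts at [n.+1] so that every normal law involved has a positive standard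
    deviation. *)
Lemma iter_shift_op_normal s n (f : R -> R) x : 0 < s -> continuous f ->
  (forall y, 0 <= f y) -> bmeas f ->
  iter n.+1 (shift_op (normal_prob 0 s) idfun) f x =
  \int[normal_prob 0 (Num.sqrt n.+1%:R * s)]_y f (x + y).
Proof.
move=> s0 cf f0 bf; elim: n x => [|n IH x]; first by rewrite /= sqrtr1 mul1r.
have q0 m : 0 < Num.sqrt m.+1%:R :> R by rewrite sqrtr_gt0 ltr0n.
have u2 : (Num.sqrt n.+2%:R * s) ^+ 2 = s ^+ 2 + (Num.sqrt n.+1%:R * s) ^+ 2.
  by rewrite !exprMn !sqr_sqrtr ?ler0n// -[n.+2%:R]natr1; ring.
rewrite iterS {1}/shift_op.
have := shift_op_normal_prob x s0 (mulr_gt0 (q0 n) s0) (mulr_gt0 (q0 n.+1) s0) u2 cf f0 bf.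
apply: etrans.
by apply: eq_Rintegral => a _; exact: IH.
Qed.

End iterated_normal.

Section iid_sums.
Context {R : realType} d (W : measurableType d) (P : probability W R).
Context d' (T : measurableType d') (X : nat -> W -> T).
Hypothesis mX : forall i, measurable_fun setT (X i).
Hypothesis identX : forall i A, measurable A -> P (X i @^-1` A) = P (X 0 @^-1` A).
Hypothesis indepX : forall (s : seq nat) (A : nat -> set T), uniq s ->
  (forall i, measurable (A i)) ->
  fine (P (\big[setI/setT]_(i <- s) (X i @^-1` A i))) =
  \prod_(i <- s) fine (P (X i @^-1` A i)).

Lemma indep_off_sub d1 (V : measurableType d1) (U : W -> V) (s s' : seq nat) :
  {subset s <= s'} -> indep_off P X U s -> indep_off P X U s'.
Proof.
move=> ss' [mU iU]; split => // B t A mB ut ts' mA; apply: iU => // i it.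
by apply: contra (ts' _ it); exact: ss'.
Qed.

Lemma indep_off_sum (g : T -> R) n : measurable_fun setT g ->
  indep_off P X (fun w => \sum_(i < n) g (X i w)) (iota 0 n).
Proof.
move=> mg; elim: n => [|n IH].
  rewrite (_ : (fun w => _) = fun=> 0); first exact: indep_off_cst.
  by apply/funext => w; rewrite big_ord0.
rewrite (_ : (fun w => _) = (fun z : R * T => z.1 + g z.2) \o
    (fun w => (\sum_(i < n) g (X i w), X n w))); last first.
  by apply/funext => w; rewrite big_ord_recr.
apply: indep_off_comp.
  apply: measurable_funD; first exact: measurable_fst.
  by apply: (measurableT_comp mg); exact: measurable_snd.
apply: (@indep_off_sub _ _ _ (n :: iota 0 n)).
  move=> i; rewrite inE !mem_iota !add0n !leq0n /= ltnS.
  by move=> /predU1P[->//|/ltnW].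
by apply: indep_off_pair => //; rewrite mem_iota ltnn andbF.
Qed.

(** Decoupling the last summand replaces [f] by its image under the operator, which is why the
    induction quantifies over [f]. *)
Lemma Rint_sum_shift_op (g : T -> R) n (f : R -> R) x : measurable_fun setT g ->
  bmeas f ->
  \int[P]_w f (x + \sum_(i < n) g (X i w)) = iter n (shift_op P (g \o X 0)) f x.
Proof.
move=> mg; elim: n f => [f bf|n IH f bf].
  by under eq_Rintegral => w _ do rewrite big_ord0 addr0; rewrite Rint_cst.
rewrite iterSr -IH; last by apply: bmeas_shift_op => //; exact: measurableT_comp.
under eq_Rintegral => w _ do rewrite big_ord_recr/= addrA.
rewrite (@Rint_decouple _ _ _ P _ _ X mX identX _ _ (fun w => \sum_(i < n) g (X i w))
  (iota 0 n) n (fun z => f (x + z.1 + g z.2)))//.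
- exact: indep_off_sum.
- by rewrite mem_iota ltnn andbF.
- apply: (bmeas_comp (h := fun z : R * T => x + z.1 + g z.2) bf).
  apply: measurable_funD; first by apply: measurable_funD => //; exact: measurable_fst.
  by apply: (measurableT_comp mg); exact: measurable_snd.
Qed.

Lemma clt_sum_bound (g : T -> R) M sigma C (f : R -> R) n :
  bmeas g -> (forall y, `|g y| <= M) -> 0 < sigma ->
  \int[P]_w g (X 0 w) = 0 -> \int[P]_w (g (X 0 w) ^+ 2) = sigma ^+ 2 ->
  bmeas f -> continuous f -> (forall y, 0 <= f y) -> 0 <= C -> taylor3 C f ->
  `|\int[P]_w f ((\sum_(i < n.+1) g (X i w)) / Num.sqrt n.+1%:R) -
    \int[normal_prob 0 sigma]_y f y| <=
  C * (M ^+ 3 + 32 * sigma ^+ 3) / Num.sqrt n.+1%:R.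
Proof.
move=> bg gM s0 g0 g2 bf cf f0 C0 Tf.
have [q qE] : exists q : R, Num.sqrt n.+1%:R = q by eexists.
rewrite qE.
have q0 : 0 < q by rewrite -qE sqrtr_gt0 ltr0n.
have qn0 : q != 0 by rewrite gt_eqF.
have q2 : n.+1%:R = q ^+ 2 :> R by rewrite -qE sqr_sqrtr.
pose g' y := q^-1 * g y.
have bg' : bmeas g' by exact: bmeasZ.
have bY := bmeas_comp bg' (mX 0).
have mY : measurable_fun setT (g' \o X 0) by case: bY.
have sq0 : 0 < sigma / q by rewrite divr_gt0.
have bgX : bmeas (fun w => g (X 0 w)) by exact: (bmeas_comp bg (mX 0)).
have -> : \int[P]_w f ((\sum_(i < n.+1) g (X i w)) / q) =
    iter n.+1 (shift_op P (g' \o X 0)) f 0.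
  rewrite -Rint_sum_shift_op//; last by case: bg'.
  apply: eq_Rintegral => w _; congr f.
  by rewrite add0r mulr_suml; apply: eq_bigr => i _; rewrite mulrC.
have -> : \int[normal_prob 0 sigma]_y f y =
    iter n.+1 (shift_op (normal_prob 0 (sigma / q)) idfun) f 0.
  have := iter_shift_op_normal n 0 sq0 cf f0 bf.
  rewrite qE (_ : q * (sigma / q) = sigma); last by field.
  by move=> ->; apply: eq_Rintegral => y _; rewrite add0r.
have bY3 : bmeas (fun w => `|g' (X 0 w)| ^+ 3).
  have [_ [K gK]] := bg'; split.
    by apply: measurable_funX; exact: measurableT_comp.
  by exists (K ^+ 3) => w; rewrite normrX normr_id lerXn2r ?nnegrE// (le_trans _ (gK (X 0 w))).
have iY : P.-integrable setT (fun w => ((g' \o X 0) w)%:E) by exact: bmeas_integrable.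
have iY2 : P.-integrable setT (fun w => ((g' \o X 0) w ^+ 2)%:E).
  by apply: (bmeas_integrable P (f := fun w => g' (X 0 w) ^+ 2)); exact: bmeasM.
have iY3 : P.-integrable setT (fun w => (`|(g' \o X 0) w| ^+ 3)%:E).
  exact: (bmeas_integrable P bY3).
have Y0 : \int[P]_w (g' \o X 0) w = 0 by rewrite /= /g' RintZ// g0 mulr0.
have Y2 : \int[P]_w ((g' \o X 0) w ^+ 2) = \int[normal_prob 0 (sigma / q)]_y (y ^+ 2).
  rewrite Rint_normal_sqr// /= /g'.
  under eq_Rintegral => w _ do rewrite exprMn.
  rewrite RintZ ?g2; first by field.
  exact: bmeasM.
have mid : measurable_fun setT (idfun : measurableTypeR R -> R) by exact: measurable_id.
have LS := (lindeberg_swap mY mid iY iY2 iY3 (integrable_normal_id sq0)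
  (integrable_normal_sqr sq0) (integrable_normal_abs3 sq0) Y0 (Rint_normal_id sq0)
  Y2 n.+1 0 bf Tf).
apply: le_trans LS _.
(* There are [q^2] replacements, each costing third moments of order [q^-3]. *)
rewrite [leRHS](_ : _ = n.+1%:R * (C * ((M / q) ^+ 3 + 32 * (sigma / q) ^+ 3))); last first.
  by rewrite q2; field.
rewrite ler_wpM2l// ler_wpM2l// lerD//; last exact: Rint_normal_abs3_le.
rewrite -[leRHS](Rint_cst P); apply: Rint_le.
- exact: bY3.
- exact: bmeas_cst.
- move=> w; rewrite lerXn2r ?nnegrE//.
    by rewrite divr_ge0 ?(ltW q0)// (le_trans _ (gM (X 0 w))).
  rewrite /= /g' normrM (gtr0_norm (_ : 0 < q^-1)) ?invr_gt0//.
  by rewrite [leLHS]mulrC ler_wpM2r// invr_ge0 ltW.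
Qed.

End iid_sums.

(** * Hajek projection *)

Section hajek_projection.
Context {R : realType} d (W : measurableType d) (P : probability W R).
Context d' (T : measurableType d') (X : nat -> W -> T).
Hypothesis mX : forall i, measurable_fun setT (X i).
Hypothesis identX : forall i A, measurable A -> P (X i @^-1` A) = P (X 0 @^-1` A).
Hypothesis indepX : forall (s : seq nat) (A : nat -> set T), uniq s ->
  (forall i, measurable (A i)) ->
  fine (P (\big[setI/setT]_(i <- s) (X i @^-1` A i))) =
  \prod_(i <- s) fine (P (X i @^-1` A i)).

Lemma indep_off1 i : indep_off P X (X i) [:: i].
Proof.
have := indep_off_pair mX (indep_off_cst mX indepX tt) (isT : i \notin [::]).
exact: (indep_off_comp (g := snd) measurable_snd).
Qed.

Lemma indep_off2 i j : i != j -> indep_off P X (fun w => (X i w, X j w)) [:: j; i].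
Proof.
by move=> ij; apply: indep_off_pair (indep_off1 i) _ => //; rewrite inE eq_sym.
Qed.

(** In the degenerate sums [i] may coincide with [k] or [l]. A variable can be adjoined only when
    its index is new, so in those cases a coordinate of the pair is duplicated instead. *)
Lemma indep_off3 i k l : k != l ->
  indep_off P X (fun w => ((X i w, X k w), X l w)) [:: i; k; l].
Proof.
move=> kl.
have kl2 := indep_off2 kl.
have m1 : measurable_fun setT (fst : T * T -> T) := measurable_fst.
have m2 : measurable_fun setT (snd : T * T -> T) := measurable_snd.
have [->|ik] := eqVneq i k.
  have := @indep_off_comp _ _ _ P _ _ X _ _ _ _ (fun z : T * T => ((z.1, z.1), z.2)) _ _ _ kl2.
  move=> /(_ (measurable_fun_pair (measurable_fun_pair m1 m1) m2)).
  by apply: indep_off_sub => j; rewrite !inE => /orP[]->; rewrite ?orbT.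
have [->|il] := eqVneq i l.
  have := @indep_off_comp _ _ _ P _ _ X _ _ _ _ (fun z : T * T => ((z.2, z.1), z.2)) _ _ _ kl2.
  move=> /(_ (measurable_fun_pair (measurable_fun_pair m2 m1) m2)).
  by apply: indep_off_sub => j; rewrite !inE => /orP[]->; rewrite ?orbT.
have ikl : i \notin [:: l; k] by rewrite !inE (negbTE ik) (negbTE il).
have p1 : measurable_fun setT (fun z : T * T * T => z.1.1).
  exact: (measurableT_comp m1 measurable_fst).
have p2 : measurable_fun setT (fun z : T * T * T => z.1.2).
  exact: (measurableT_comp m2 measurable_fst).
have p3 : measurable_fun setT (fun z : T * T * T => z.2) by exact: measurable_snd.
have := @indep_off_comp _ _ _ P _ _ X _ _ _ _
  (fun z : T * T * T => ((z.2, z.1.1), z.1.2)) _ _ _ (indep_off_pair mX kl2 ikl).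
move=> /(_ (measurable_fun_pair (measurable_fun_pair p3 p1) p2)).
by apply: indep_off_sub => j; rewrite !inE => /or3P[]->; rewrite ?orbT.
Qed.

Section degenerate.
Variables (psi : T * T -> R) (K : R).
Hypotheses (bpsi : bmeas psi) (psiK : forall z, `|psi z| <= K)
  (psiC : forall x y, psi (x, y) = psi (y, x))
  (psi0 : forall x, \int[P]_w psi (x, X 0 w) = 0).

(** The index [j] occurs once, so integrating [X j] out with the other variables frozen produces the
    factor killed by [psi0]. *)
Lemma Rint_degenerate_eq0 i j k l : j != i -> j != k -> j != l -> k != l ->
  \int[P]_w (psi (X i w, X j w) * psi (X k w, X l w)) = 0.
Proof.
move=> ji jk jl kl.
have jikl : j \notin [:: i; k; l] by rewrite !inE !negb_or ji jk jl.
have m1 := @measurable_fst _ _ (T * T * T)%type T.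
have m2 := @measurable_snd _ _ (T * T * T)%type T.
have m11 := measurableT_comp (@measurable_fst _ _ (T * T)%type T) m1.
pose f (z : T * T * T * T) := psi (z.1.1.1, z.2) * psi (z.1.1.2, z.1.2).
have bf : bmeas f.
  apply: bmeasM.
    apply: (bmeas_comp (h := fun z : T * T * T * T => (z.1.1.1, z.2)) bpsi).
    apply: measurable_fun_pair => //.
    exact: (measurableT_comp (@measurable_fst _ _ T T) m11).
  apply: (bmeas_comp (h := fun z : T * T * T * T => (z.1.1.2, z.1.2)) bpsi).
  apply: measurable_fun_pair; first exact: (measurableT_comp (@measurable_snd _ _ T T) m11).
  exact: (measurableT_comp (@measurable_snd _ _ (T * T)%type T) m1).
rewrite (Rint_decouple mX identX (indep_off3 i kl) jikl bf) /f /=.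
rewrite -[RHS](Rint_cst P); apply: eq_Rintegral => w _.
under eq_Rintegral => w' _ do rewrite mulrC.
rewrite RintZ ?psi0 ?mulr0//.
by apply: (bmeas_comp (h := fun w' => (X i w, X 0 w')) bpsi); exact: measurable_fun_pair.
Qed.

Lemma bmeas_psi i j : bmeas (fun w => psi (X i w, X j w)).
Proof.
by apply: (bmeas_comp (h := fun w => (X i w, X j w)) bpsi); exact: measurable_fun_pair.
Qed.

Definition off_diag_sum n w := \sum_(i < n) \sum_(j < n | j != i) psi (X i w, X j w).

Lemma bmeas_off_diag_sum n : bmeas (off_diag_sum n).
Proof.
by apply: bmeas_sum => i _; apply: bmeas_sum => j _; exact: bmeas_psi.
Qed.

(** In the expanded square, a pair [(i, j)] has nonzero covariance at most with [(i, j)] and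
    [(j, i)]: otherwise some index occurs only once. Each of the at most [n^2] pairs thus
    contributes at most [2 K^2]. *)
Lemma Rint_off_diag_sum_sqr n :
  \int[P]_w (off_diag_sum n w ^+ 2) <= 2 * K ^+ 2 * n%:R ^+ 2.
Proof.
have K0 : 0 <= K ^+ 2 by exact: sqr_ge0.
pose F (p : 'I_n * 'I_n) w := psi (X p.1 w, X p.2 w).
have bF p : bmeas (F p) by exact: bmeas_psi.
have FK p q : \int[P]_w (F p w * F q w) <= K ^+ 2.
  apply: le_trans (ler_norm _) _; apply: Rint_norm_le; first exact: bmeasM.
  by move=> w; rewrite normrM expr2 ler_pM ?psiK.
have sqrE w : off_diag_sum n w ^+ 2 =
    \sum_(p : 'I_n * 'I_n | p.2 != p.1) \sum_(q : 'I_n * 'I_n | q.2 != q.1) F p w * F q w.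
  rewrite /off_diag_sum pair_big_dep /= expr2 big_distrlr /=.
  by [].
under eq_Rintegral => w _ do rewrite sqrE.
rewrite Rint_sum; last by move=> p _; apply: bmeas_sum => q _; exact: bmeasM.
have cardE : \sum_(p : 'I_n * 'I_n) (2 * K ^+ 2) = 2 * K ^+ 2 * n%:R ^+ 2 :> R.
  by rewrite sumr_const card_prod !card_ord -(mulr_natr (2 * K ^+ 2)) natrM expr2.
rewrite -cardE [leRHS](bigID (fun p : 'I_n * 'I_n => p.2 != p.1)) /= -[leLHS]addr0.
apply: lerD; last by apply: sumr_ge0 => p _; rewrite mulr_ge0.
apply: ler_sum => -[i j] /= ji.
rewrite Rint_sum; last by move=> q _; exact: bmeasM.
have deltaE (r : 'I_n * 'I_n) : \sum_(q : 'I_n * 'I_n) (q == r)%:R * K ^+ 2 = K ^+ 2 :> R.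
  rewrite (bigD1 r)//= eqxx mul1r big1 ?addr0// => q /negbTE ->.
  by rewrite mul0r.
(* The bound is spread over the two surviving pairs so that the sums compare term by term. *)
have -> : 2 * K ^+ 2 = \sum_(q : 'I_n * 'I_n)
    ((q == (i, j))%:R * K ^+ 2 + (q == (j, i))%:R * K ^+ 2).
  by rewrite big_split /= !deltaE; ring.
rewrite [leRHS](bigID (fun q : 'I_n * 'I_n => q.2 != q.1)) /= -[leLHS]addr0.
apply: lerD; last by apply: sumr_ge0 => q _; apply: addr_ge0; apply: mulr_ge0.
apply: ler_sum => -[k l] /= lk.
have [/eqP[-> ->]|q1] := boolP ((k, l) == (i, j)).
  by rewrite mul1r (le_trans (FK _ _))// lerDl mulr_ge0.
have [/eqP[-> ->]|q2] := boolP ((k, l) == (j, i)).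
  by rewrite mul1r (le_trans (FK _ _))// lerDr mulr_ge0.
rewrite !mul0r addr0 le_eqVlt; apply/orP; left; apply/eqP; rewrite /F /=.
(* If [j] is neither [k] nor [l] it is the isolated index; otherwise [i] is, and symmetry moves [i]
   to the second slot. *)
have kl : (k : nat) != l by rewrite eq_sym.
have [jk|jk] := eqVneq (j : nat) k; last first.
  have [jl|jl] := eqVneq (j : nat) l; last exact: Rint_degenerate_eq0.
  have ik : (i : nat) != k.
    apply: contraNneq q1 => /val_inj ik; move/val_inj: jl => jl.
    by rewrite ik jl.
  have il : (i : nat) != l by rewrite -jl eq_sym.
  under eq_Rintegral => w _ do rewrite psiC.
  by apply: Rint_degenerate_eq0 => //; rewrite eq_sym.
have il : (i : nat) != l.
  apply: contraNneq q2 => /val_inj il; move/val_inj: jk => jk.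
  by rewrite il jk.
have ik : (i : nat) != k by rewrite -jk eq_sym.
under eq_Rintegral => w _ do rewrite psiC.
by apply: Rint_degenerate_eq0 => //; rewrite eq_sym.
Qed.

End degenerate.

Section projection.
Variable k : T * T -> R.
Hypothesis bk : bmeas k.

(** There is no factor 1/2, so that this is [hij]. The U-statistic has kernel [h / 2], and that half
    cancels the 2 of its projection, leaving [(1/n) sum_i g(X_i)]. *)
Definition sym_kernel (z : T * T) : R := k z + k (z.2, z.1).
Notation h := sym_kernel.

Definition kernel_mean : R := \int[P]_w h (X 0 w, X 1 w).
Notation theta := kernel_mean.

Definition hajek (x : T) : R := \int[P]_w h (x, X 0 w) - theta.
Notation g := hajek.

Lemma bmeas_sym_kernel : bmeas h.
Proof.
apply: bmeasD => //; apply: (bmeas_comp (h := fun z : T * T => (z.2, z.1)) bk).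
by apply: measurable_fun_pair; [exact: measurable_snd|exact: measurable_fst].
Qed.

Lemma bmeas_hajek : bmeas g.
Proof.
apply: bmeasB; last exact: bmeas_cst.
apply: (bmeas_Rint2 (T1 := T) (dirac (X 0 point)) P (f := fun z => h (z.1, X 0 z.2))).
apply: (bmeas_comp (h := fun z : T * W => (z.1, X 0 z.2)) bmeas_sym_kernel).
apply: measurable_fun_pair; first exact: measurable_fst.
by apply: (measurableT_comp (mX 0)); exact: measurable_snd.
Qed.

Let bX0 (f : T -> R) : bmeas f -> bmeas (fun w => f (X 0 w)).
Proof. by move=> bf; exact: (bmeas_comp bf (mX 0)). Qed.

Let bhX x : bmeas (fun w => h (x, X 0 w)).
Proof.
apply: (bmeas_comp (h := fun w => (x, X 0 w)) bmeas_sym_kernel).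
exact: measurable_fun_pair.
Qed.

Let theta_iter : \int[P]_w \int[P]_w' h (X 0 w, X 0 w') = theta.
Proof.
have j1 : 1%N \notin [:: 0%N] by [].
by rewrite /theta (Rint_decouple mX identX (indep_off1 0) j1 bmeas_sym_kernel).
Qed.

Lemma Rint_hajek : \int[P]_w g (X 0 w) = 0.
Proof.
rewrite /g RintB; last exact: bmeas_cst.
  by rewrite theta_iter Rint_cst subrr.
have := bmeasD bmeas_hajek (bmeas_cst _ theta).
rewrite (_ : (fun x => _) = fun x => \int[P]_w h (x, X 0 w)); last first.
  by apply/funext => x; rewrite /g subrK.
exact: bX0.
Qed.

(** Given [X 0], the two factors are independent with conditional mean [g + theta]: integrating out
    [X 2] and then [X 1] leaves [(g + theta)^2], and [g] is centred. *)
Lemma Rint_hajek_sqr : \int[P]_w (g (X 0 w) ^+ 2) =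
  \int[P]_w (h (X 0 w, X 1 w) * h (X 0 w, X 2 w)) - theta ^+ 2.
Proof.
have j2 : 2%N \notin [:: 1%N; 0%N] by [].
have j1 : 1%N \notin [:: 0%N] by [].
have h1E x : \int[P]_w h (x, X 0 w) = g x + theta by rewrite /g subrK.
pose f3 (z : T * T * T) := h z.1 * h (z.1.1, z.2).
have bf3 : bmeas f3.
  apply: bmeasM; first exact: (bmeas_comp bmeas_sym_kernel measurable_fst).
  apply: (bmeas_comp (h := fun z : T * T * T => (z.1.1, z.2)) bmeas_sym_kernel).
  apply: measurable_fun_pair; last exact: measurable_snd.
  exact: (measurableT_comp (@measurable_fst _ _ T T) (@measurable_fst _ _ (T * T)%type T)).
have i01 : indep_off P X (fun w => (X 0 w, X 1 w)) [:: 1%N; 0%N] by exact: indep_off2.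
apply: esym; have := Rint_decouple mX identX i01 j2 bf3; rewrite /f3 /= => ->.
transitivity (\int[P]_w (h (X 0 w, X 1 w) * (g (X 0 w) + theta)) - theta ^+ 2).
  by congr (_ - _); apply: eq_Rintegral => w _; rewrite RintZ// h1E.
pose f2 (z : T * T) := h z * (g z.1 + theta).
have bgt : bmeas (fun x => g x + theta).
  by apply: bmeasD; [exact: bmeas_hajek|exact: bmeas_cst].
have bf2 : bmeas f2.
  by apply: bmeasM; [exact: bmeas_sym_kernel|exact: (bmeas_comp bgt measurable_fst)].
have := Rint_decouple mX identX (indep_off1 0) j1 bf2; rewrite /f2 /= => ->.
transitivity (\int[P]_w ((g (X 0 w) ^+ 2 + (2 * theta) * g (X 0 w)) + theta ^+ 2) -
  theta ^+ 2); last first.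
  have bg := bX0 bmeas_hajek.
  have bg2 : bmeas (fun w => g (X 0 w) ^+ 2) by exact: bmeasM.
  rewrite RintD; [|by apply: bmeasD => //; exact: bmeasZ|exact: bmeas_cst].
  rewrite RintD//; last exact: bmeasZ.
  by rewrite RintZ// Rint_hajek Rint_cst mulr0 addr0 addrK.
congr (_ - _); apply: eq_Rintegral => w _.
under eq_Rintegral => w' _ do rewrite mulrC.
rewrite RintZ// h1E; ring.
Qed.

(** The remainder is summed over ordered pairs, so the 2 in the denominator makes each unordered
    pair count once. *)
Definition hajek_rest (z : T * T) : R := (h z - theta - g z.1 - g z.2) / 2.

Lemma bmeas_hajek_rest : bmeas hajek_rest.
Proof.
apply: bmeasM; last exact: bmeas_cst.
apply: bmeasB; last exact: (bmeas_comp bmeas_hajek measurable_snd).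
apply: bmeasB; last exact: (bmeas_comp bmeas_hajek measurable_fst).
by apply: bmeasB; [exact: bmeas_sym_kernel|exact: bmeas_cst].
Qed.

Lemma hajek_restC x y : hajek_rest (x, y) = hajek_rest (y, x).
Proof. by rewrite /hajek_rest /h /=; congr (_ / 2); ring. Qed.

Lemma Rint_hajek_rest x : \int[P]_w hajek_rest (x, X 0 w) = 0.
Proof.
have bg := bX0 bmeas_hajek.
have b1 : bmeas (fun w => h (x, X 0 w) - theta) by apply: bmeasB => //; exact: bmeas_cst.
have b2 : bmeas (fun w => h (x, X 0 w) - theta - g x) by apply: bmeasB => //; exact: bmeas_cst.
have b3 : bmeas (fun w => h (x, X 0 w) - theta - g x - g (X 0 w)) by exact: bmeasB.
rewrite /hajek_rest /=; under eq_Rintegral => w _ do rewrite mulrC.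
rewrite RintZ// RintB// RintB//; last exact: bmeas_cst.
rewrite RintB//; last exact: bmeas_cst.
by rewrite Rint_hajek !Rint_cst subr0 /g subrr mulr0.
Qed.

Lemma hajek_decomposition n w :
  \sum_(i < n) \sum_(j < n | j != i) k (X i w, X j w) =
  off_diag_sum hajek_rest n w + (n * (n - 1))%:R * (theta / 2) +
  (n - 1)%:R * \sum_(i < n) g (X i w).
Proof.
pose S (F : 'I_n -> 'I_n -> R) := \sum_(i < n) \sum_(j < n | j != i) F i j.
have SC F : S F = S (fun i j => F j i).
  rewrite /S (exchange_big_dep predT)//=; apply: eq_bigr => i _.
  by apply: eq_bigl => j; rewrite eq_sym.
have SD F G : S (fun i j => F i j + G i j) = S F + S G.
  by rewrite /S -big_split; apply: eq_bigr => i _; rewrite big_split.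
have card1 (i : 'I_n) : #|[pred j : 'I_n | j != i]| = (n - 1)%N.
  by rewrite (cardC1 i) card_ord subn1.
have S1 (a : 'I_n -> R) : S (fun i _ => a i) = (n - 1)%:R * \sum_(i < n) a i.
  rewrite /S mulr_sumr; apply: eq_bigr => i _.
  by rewrite sumr_const card1 mulr_natl.
have S2 (a : 'I_n -> R) : S (fun _ j => a j) = (n - 1)%:R * \sum_(i < n) a i.
  by rewrite SC S1.
have Sc (c : R) : S (fun _ _ => c) = (n * (n - 1))%:R * c.
  by rewrite S1 sumr_const card_ord -(mulr_natr c) natrM; ring.
have [a aE] : exists a : 'I_n -> R, a = fun i => g (X i w) by eexists.
have -> : \sum_(i < n) g (X i w) = \sum_(i < n) a i by rewrite aE.
set LHS := LHS.
have LE : LHS = S (fun i j => k (X i w, X j w)) by [].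
(* Only [k(x, y) + k(y, x)] decomposes termwise, so the sum is doubled with one copy transposed by
   [SC], and halved at the end. *)
have L2 : LHS + LHS = S (fun i j => (hajek_rest (X i w, X j w) + hajek_rest (X i w, X j w))
    + theta + a i + a j).
  rewrite {1}LE {1}LE {2}[S _]SC -SD /S; apply: eq_bigr => i _; apply: eq_bigr => j _.
  by rewrite aE /hajek_rest /h /=; field.
rewrite !SD Sc S1 S2 in L2.
have offE : S (fun i j => hajek_rest (X i w, X j w)) = off_diag_sum hajek_rest n w by [].
rewrite offE in L2; move: L2; clear LE.
move: LHS => l; move: (off_diag_sum _ n w) theta (\sum_(i < n) a i) => o th sg.
move: ((n * (n - 1))%:R : R) ((n - 1)%:R : R) => c b L2.
have -> : l = (l + l) / 2 by field.
by rewrite L2; field.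
Qed.

End projection.
End hajek_projection.

(** * Convergence in law *)

Section normal_cdf.
Context {R : realType} (s : R).
Hypothesis s0 : 0 < s.

Lemma measurable_le_set (x : R) : measurable ([set y | y <= x] : set (measurableTypeR R)).
Proof.
rewrite (_ : [set y | y <= x] = [set` `]-oo, x]]); first exact: measurable_itv.
by apply/seteqP; split => y /=; rewrite in_itv.
Qed.

Lemma normal_cdf_shift (x a : R) : 0 <= a ->
  fine (normal_prob 0 s [set y | y <= x + a]) <=
  fine (normal_prob 0 s [set y | y <= x]) + a * normal_peak s.
Proof.
move=> a0.
have mI : measurable ([set` `]x, x + a]] : set (measurableTypeR R)) by exact: measurable_itv.
have fin A : measurable A -> normal_prob 0 s A \is a fin_num.
  by move=> mA; apply: fin_num_measure.
have -> : [set y | y <= x + a] = [set y | y <= x] `|` [set` `]x, x + a]].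
  apply/seteqP; split => y /=; rewrite in_itv/=.
    by have [yx _|xy ->] := leP y x; [left|right].
  by case=> [yx|/andP[]//]; rewrite (le_trans yx)// lerDl.
rewrite measureU//; last 2 first.
- exact: measurable_le_set.
- apply/seteqP; split => y //= [yx]; rewrite in_itv/= => /andP[xy _].
  by move: (lt_le_trans xy yx); rewrite ltxx.
rewrite fineD ?fin//; last exact: measurable_le_set.
rewrite lerD2l -lee_fin fineK ?fin//.
suff : (\int[lebesgue_measure]_(y in `]x, (x + a)%R]) (normal_pdf 0 s y)%:E <=
  (a * normal_peak s)%:E)%E by [].
apply: (@le_trans _ _ (\int[lebesgue_measure]_(y in `]x, (x + a)%R]) (normal_peak s)%:E)%E).
  apply: ge0_le_integral => //.
  - by move=> y _; rewrite lee_fin normal_pdf_ge0.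
  - by apply/measurable_EFinP/measurable_funTS; exact: measurable_normal_pdf.
  - by move=> y _; rewrite lee_fin normal_pdf_ub// gt_eqF.
rewrite integral_cst//= lebesgue_measure_itv/= lte_fin.
case: ifPn => _; last by rewrite mule0 lee_fin mulr_ge0// normal_peak_ge0.
by rewrite -EFinD -EFinM lee_fin mulrC addrAC subrr add0r.
Qed.

Lemma Rint_normal_step_down (x delta : R) : 0 < delta ->
  fine (normal_prob 0 s [set y | y <= x]) <=
    \int[normal_prob 0 s]_y step_down x delta y <=
  fine (normal_prob 0 s [set y | y <= x + 3 * delta]).
Proof.
move=> d0.
have mf := continuous_measurable_fun (@continuous_step_down R x delta).
have bf : bmeas (step_down x delta : measurableTypeR R -> R).
  split; first exact: mf.
  by exists 1 => y; have /andP[? ?] := step_down_itv x delta y; rewrite ger0_norm.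
have bI c : bmeas (\1_[set y | y <= c] : measurableTypeR R -> R).
  by apply: bmeas_indic; exact: measurable_le_set.
rewrite -!Rint_indic; try exact: measurable_le_set.
apply/andP; split; apply: Rint_le => // y; rewrite indicE.
  have [/set_mem/= yx|_] := boolP (_ \in _); first by rewrite step_down_eq1.
  by have /andP[] := step_down_itv x delta y.
have [_|/negP] := boolP (_ \in _); first by have /andP[] := step_down_itv x delta y.
rewrite inE /= => /negP; rewrite -ltNge => xy.
by rewrite step_down_eq0// ltW.
Qed.

End normal_cdf.

Section ustat_clt.
Context {R : realType} d (W : measurableType d) (P : probability W R).
Context d' (T : measurableType d') (X : nat -> W -> T).
Hypothesis mX : forall i, measurable_fun setT (X i).
Hypothesis identX : forall i A, measurable A -> P (X i @^-1` A) = P (X 0 @^-1` A).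
Hypothesis indepX : forall (s : seq nat) (A : nat -> set T), uniq s ->
  (forall i, measurable (A i)) ->
  fine (P (\big[setI/setT]_(i <- s) (X i @^-1` A i))) =
  \prod_(i <- s) fine (P (X i @^-1` A i)).
Variable k : T * T -> R.
Hypothesis bk : bmeas k.

Notation theta := (kernel_mean P X k).
Notation g := (hajek P X k).
Notation psi := (hajek_rest P X k).

Let stat (n : nat) (w : W) : R := Num.sqrt n%:R *
  ((\sum_(i < n) \sum_(j < n | j != i) k (X i w, X j w)) / (n * (n - 1))%:R - theta / 2).

Let lead n w : R := (\sum_(i < n) g (X i w)) / Num.sqrt n%:R.
Let rest n w : R := (Num.sqrt n%:R * (n - 1)%:R)^-1 * off_diag_sum X psi n w.

(** Sizes are written [n.+2] because [n (n - 1)] has to be nonzero. *)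
Let statE n w : stat n.+2 w = lead n.+2 w + rest n.+2 w.
Proof.
rewrite /stat /lead /rest (hajek_decomposition P X k) natrM subn1 /=.
have [q qE] : exists q : R, Num.sqrt n.+2%:R = q by eexists.
rewrite qE.
have q0 : q != 0 by rewrite -qE gt_eqF// sqrtr_gt0.
have q2 : n.+2%:R = q ^+ 2 :> R by rewrite -qE sqr_sqrtr.
rewrite q2.
have : n.+1%:R != 0 :> R by rewrite pnatr_eq0.
move: (n.+1%:R : R) (off_diag_sum _ _ _ _) (\sum_(i < _) _) theta => r o sg th r0.
by field; rewrite r0 q0.
Qed.

Let bg : bmeas g. Proof. exact: bmeas_hajek. Qed.
Let bpsi : bmeas psi. Proof. exact: bmeas_hajek_rest. Qed.

Let blead n : bmeas (lead n).
Proof.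
apply: bmeasM; last exact: bmeas_cst.
by apply: bmeas_sum => i _; exact: (bmeas_comp bg (mX i)).
Qed.

Let brest n : bmeas (rest n).
Proof. by apply: bmeasZ; exact: bmeas_off_diag_sum. Qed.

Let mstat n t : measurable [set w | stat n w <= t].
Proof.
have bs : bmeas (stat n).
  apply: bmeasZ; apply: bmeasB; last exact: bmeas_cst.
  apply: bmeasM; last exact: bmeas_cst.
  apply: bmeas_sum => i _; apply: bmeas_sum => j _.
  apply: (bmeas_comp (h := fun w => (X i w, X j w)) bk).
  exact: measurable_fun_pair.
rewrite (_ : [set w | _] = stat n @^-1` [set` `]-oo, t]]).
  by rewrite -[X in measurable X]setTI; case: bs => + _; apply => //; exact: measurable_itv.
by apply/seteqP; split => w /=; rewrite in_itv.
Qed.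

(** The second moment is of order [1/n]; it is weakened to the rate of [lead_close] so that the
    errors add up. With [p^2 = n.+1], the constant 4 comes from [2 (p^2 + 1) <= 4 p^3] for
    [p >= 1]. *)
Let rest_sqr : exists B, 0 <= B /\
  forall n, \int[P]_w (rest n.+2 w ^+ 2) <= B / Num.sqrt n.+1%:R.
Proof.
have [_ [K psiK]] := bpsi; exists (4 * K ^+ 2); split.
  by rewrite mulr_ge0// sqr_ge0.
move=> n; rewrite /rest subn1 /=.
under eq_Rintegral => w _ do rewrite exprMn.
rewrite RintZ; last by apply: bmeasM; exact: bmeas_off_diag_sum.
have le1 := Rint_off_diag_sum_sqr mX identX indepX bpsi psiK
  (hajek_restC P X k) (Rint_hajek_rest mX identX indepX bk) n.+2.
apply: le_trans (ler_wpM2l (sqr_ge0 _) le1) _.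
have [p pE] : exists p : R, Num.sqrt n.+1%:R = p by eexists.
have p1 : 1 <= p by rewrite -pE -[leLHS]sqrtr1 ler_wsqrtr// ler1n.
have p2 : n.+1%:R = p ^+ 2 :> R by rewrite -pE sqr_sqrtr.
have q2 : Num.sqrt n.+2%:R ^+ 2 = p ^+ 2 + 1 :> R.
  by rewrite sqr_sqrtr ?ler0n// -natr1 p2.
rewrite pE exprVn exprMn q2 -[n.+2%:R]natr1 p2.
have p0 : p != 0 by rewrite gt_eqF// (lt_le_trans ltr01).
have pp0 : p ^+ 2 + 1 != 0 by rewrite gt_eqF// ltr_wpDl// sqr_ge0.
rewrite [leLHS](_ : _ = K ^+ 2 / p * (2 * (p ^+ 2 + 1) / p ^+ 3)); last first.
  by field; rewrite p0 pp0.
rewrite [leRHS](_ : _ = K ^+ 2 / p * 4); last by ring.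
apply: ler_wpM2l; first by rewrite divr_ge0 ?sqr_ge0// (le_trans ler01).
rewrite ler_pdivrMr ?exprn_gt0 ?(lt_le_trans ltr01)//.
have : 0 <= p ^+ 2 * (p - 1) by rewrite mulr_ge0 ?sqr_ge0// subr_ge0.
have : 1 <= p ^+ 2 by rewrite exprn_ege1.
rewrite -[p ^+ 3]/(p * (p * p)) -expr2; nra.
Qed.

Variable sigma : R.
Hypotheses (sigma0 : 0 < sigma) (sigmaE : \int[P]_w (g (X 0 w) ^+ 2) = sigma ^+ 2).

Let F x := fine (normal_prob 0 sigma [set y | y <= x]).

Let lead_close x delta : 0 < delta -> exists B, 0 <= B /\ forall n,
  `|\int[P]_w step_down x delta (lead n.+2 w) -
    \int[normal_prob 0 sigma]_y step_down x delta y| <= B / Num.sqrt n.+1%:R.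
Proof.
move=> d0; have [C TC] := taylor3_step_down x delta.
have C0 : 0 <= C.
  have [a [b /(_ 1)]] := TC 0.
  by rewrite normr1 !expr1n !mulr1; apply: le_trans.
have [_ [M gM]] := bg.
have M0 : 0 <= M by apply: le_trans (gM point); exact: normr_ge0.
have B0 : 0 <= C * (M ^+ 3 + 32 * sigma ^+ 3).
  have s3 : 0 <= sigma ^+ 3 by rewrite exprn_ge0// ltW.
  by apply: mulr_ge0 => //; apply: addr_ge0; [exact: exprn_ge0|exact: mulr_ge0].
exists (C * (M ^+ 3 + 32 * sigma ^+ 3)); split => // n.
have f01 y := step_down_itv x delta y.
have cf := @continuous_step_down R x delta.
have bf : bmeas (step_down x delta : R -> R).
  split; first exact: continuous_measurable_fun.
  by exists 1 => y; have /andP[? ?] := f01 y; rewrite ger0_norm.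
have f0 y : 0 <= step_down x delta y by have /andP[] := f01 y.
have le1 := clt_sum_bound mX identX indepX n.+1 bg gM sigma0
  (Rint_hajek mX identX indepX bk) sigmaE bf cf f0 C0 TC.
apply: (le_trans le1); apply: ler_wpM2l => //.
by rewrite lef_pV2 ?posrE ?sqrtr_gt0// ler_wsqrtr// ler_nat.
Qed.

(** The upper step descends on [[t + delta, t + 4 delta]], the lower one on
    [[t - 4 delta, t - delta]]. Both keep a margin [delta] from [t] to absorb the remainder, and
    both stay within [4 delta] of [t], where the normal distribution function varies by at most
    [4 delta] times the peak. *)
Lemma ustat_cdf_close t delta : 0 < delta -> exists B, 0 <= B /\ forall n,
  `|fine (P [set w | stat n.+2 w <= t]) - F t| <=
    4 * delta * normal_peak sigma + B / Num.sqrt n.+1%:R.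
Proof.
move=> d0.
have [Br [Br0 restB]] := rest_sqr.
have [B1 [B10 lead1]] := lead_close (t + delta) d0.
have [B2 [B20 lead2]] := lead_close (t - 4 * delta) d0.
have dd0 : 0 < delta ^+ 2 by rewrite exprn_gt0.
exists (B1 + B2 + Br / delta ^+ 2); split.
  by rewrite !addr_ge0// divr_ge0// ltW.
move=> n; set q := Num.sqrt _.
have q0 : 0 < q by rewrite sqrtr_gt0.
have bstep x : bmeas (fun w => step_down x delta (lead n.+2 w)).
  have cf := @continuous_step_down R x delta.
  apply: (bmeas_comp (f := step_down x delta) _ (blead n.+2).1).
  split; first exact: continuous_measurable_fun.
  by exists 1 => y; have /andP[? ?] := step_down_itv x delta y; rewrite ger0_norm.
have brest2 : bmeas (fun w => (delta ^+ 2)^-1 * rest n.+2 w ^+ 2).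
  by apply: bmeasZ; apply: bmeasM.
have rest_small : \int[P]_w ((delta ^+ 2)^-1 * rest n.+2 w ^+ 2) <= Br / delta ^+ 2 / q.
  rewrite RintZ; last by apply: bmeasM.
  rewrite mulrAC [leRHS]mulrC; apply: ler_wpM2l; last exact: restB.
  by rewrite invr_ge0 ltW.
(* Chebyshev's inequality in pointwise form: where the remainder is large, this term dominates the
   indicator by itself. *)
have rest_big w : delta < `|rest n.+2 w| -> 1 <= (delta ^+ 2)^-1 * rest n.+2 w ^+ 2.
  move=> dr; rewrite mulrC ler_pdivlMr// mul1r -(real_normK (num_real (rest _ _))).
  by rewrite lerXn2r ?nnegrE// ltW.
have rest_ge0 w : 0 <= (delta ^+ 2)^-1 * rest n.+2 w ^+ 2.
  by rewrite mulr_ge0 ?sqr_ge0// invr_ge0 ltW.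
have bI : bmeas (\1_[set w | stat n.+2 w <= t] : W -> R) by exact: bmeas_indic.
rewrite -Rint_indic//.
have up : \int[P]_w \1_[set w | stat n.+2 w <= t] w <=
    \int[P]_w step_down (t + delta) delta (lead n.+2 w) + Br / delta ^+ 2 / q.
  apply: (le_trans _ (lerD (lexx _) rest_small)); rewrite -RintD//.
  apply: Rint_le => //; first exact: bmeasD.
  move=> w; rewrite indicE.
  have /andP[f0 f1] := step_down_itv (t + delta) delta (lead n.+2 w).
  have [/set_mem/=|_] := boolP (_ \in _); last by rewrite addr_ge0.
  rewrite statE => le_t.
  have [dr|dr] := ltP delta `|rest n.+2 w|.
    by rewrite (le_trans (rest_big w dr))// lerDr.
  rewrite step_down_eq1 ?lerDl//.
  by move: dr; rewrite ler_norml => /andP[]; lra.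
have lo : \int[P]_w step_down (t - 4 * delta) delta (lead n.+2 w) - Br / delta ^+ 2 / q <=
    \int[P]_w \1_[set w | stat n.+2 w <= t] w.
  rewrite lerBlDr; apply: (le_trans _ (lerD (lexx _) rest_small)); rewrite -RintD//.
  apply: Rint_le => //; first exact: bmeasD.
  move=> w; rewrite indicE.
  have /andP[f0 f1] := step_down_itv (t - 4 * delta) delta (lead n.+2 w).
  have [_|/negP] := boolP (_ \in _); first by rewrite (le_trans f1)// lerDl.
  rewrite inE /= => /negP; rewrite -ltNge statE => gt_t; rewrite add0r.
  have [dr|dr] := ltP delta `|rest n.+2 w|; first exact: le_trans (rest_big w dr).
  rewrite step_down_eq0//.
  by move: dr; rewrite ler_norml => /andP[]; lra.
have := lead1 n; have := lead2 n; rewrite -/q.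
have /andP[_] := Rint_normal_step_down sigma (t + delta) d0.
have /andP[+ _] := Rint_normal_step_down sigma (t - 4 * delta) d0.
have d40 : 0 <= 4 * delta by rewrite mulr_ge0// ltW.
have := normal_cdf_shift sigma0 t d40.
have := normal_cdf_shift sigma0 (t - 4 * delta) d40.
rewrite subrK (_ : t + delta + 3 * delta = t + 4 * delta); last by ring.
have -> : (B1 + B2 + Br / delta ^+ 2) / q = B1 / q + B2 / q + Br / delta ^+ 2 / q.
  by rewrite !mulrDl.
rewrite -!/(F _) !ler_norml.
have B1q : 0 <= B1 / q by rewrite divr_ge0// ltW.
have B2q : 0 <= B2 / q by rewrite divr_ge0// ltW.
move=> s1 s2 l1 l2 /andP[a1 a2] /andP[b1 b2].
apply/andP; split; lra.
Qed.

Lemma ustat_cvg t :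
  (fun n => P [set w | stat n w <= t]) @ \oo --> normal_prob 0 sigma [set x | x <= t].
Proof.
have finP n : P [set w | stat n w <= t] \is a fin_num by apply: fin_num_measure.
have finN : normal_prob 0 sigma [set x | x <= t] \is a fin_num.
  by apply: fin_num_measure; exact: measurable_le_set.
rewrite -(fineK finN).
rewrite (_ : (fun n => _) = EFin \o (fun n => fine (P [set w | stat n w <= t]))); last first.
  by apply/funext => n /=; rewrite fineK.
apply: cvg_EFin; first by apply: nearW => n.
rewrite (_ : fine \o _ = fun n => fine (P [set w | stat n w <= t]))//.
apply/cvgrPdist_le => e e0.
have pk0 : 0 < normal_peak sigma by apply: normal_peak_gt0; rewrite gt_eqF.
(* Chosen so that [4 delta] times the peak is [e / 2]; the other half is left for the term in
   [B]. *)
pose delta := e / (8 * normal_peak sigma).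
have d0 : 0 < delta by rewrite divr_gt0// mulr_gt0.
have [B [B0 close]] := ustat_cdf_close t d0.
have dE : 4 * delta * normal_peak sigma = e / 2 by rewrite /delta; field; rewrite gt_eqF.
near=> n.
have n2 : (2 <= n)%N by near: n; exact: nbhs_infty_ge.
(* The extra 1 accounts for the rate being in [m.+1 = n - 1]. *)
have nB : (2 * B / e) ^+ 2 + 1 <= n%:R by near: n; exact: nbhs_infty_ger.
have [m nE] : exists m, n = m.+2 by exists (n - 2)%N; rewrite -addn2 subnK.
rewrite nE distrC; apply: le_trans (close m) _; rewrite dE.
have q0 : 0 < Num.sqrt m.+1%:R :> R by rewrite sqrtr_gt0.
suff : B / Num.sqrt m.+1%:R <= e / 2 by lra.
have x0 : 0 <= 2 * B / e by rewrite divr_ge0 ?mulr_ge0// ltW.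
have xq : 2 * B / e <= Num.sqrt m.+1%:R.
  rewrite -(@ler_pXn2r _ 2)// ?nnegrE// ?(ltW q0)// sqr_sqrtr//.
  by move: nB; rewrite nE -natr1; lra.
rewrite ler_pdivrMr//; move: xq; rewrite ler_pdivrMr//; lra.
Unshelve. all: end_near.
Qed.

End ustat_clt.

(** * Measurability of the proximity region *)

Section proximity_measurable.
Context {R : realType}.
Notation pt := (R * R)%type.
Implicit Types (p x y : pt) (r : \bar R).

Section level_sets.
Context d (W : measurableType d).

Lemma measurable_ge0_set (f : W -> R) : measurable_fun setT f ->
  measurable [set w | 0 <= f w].
Proof.
move=> mf; rewrite (_ : [set w | _] = f @^-1` [set` `[0, +oo[]).
  by rewrite -[X in measurable X]setTI; apply: mf => //; exact: measurable_itv.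
by apply/seteqP; split => w /=; rewrite in_itv/= andbT.
Qed.

Lemma measurable_eq_set (f g : W -> R) : measurable_fun setT f -> measurable_fun setT g ->
  measurable [set w | f w = g w].
Proof.
move=> mf mg; rewrite (_ : [set w | _] = (fun w => f w - g w) @^-1` [set 0]).
  have mfg : measurable_fun setT (fun w => f w - g w) by exact: measurable_funB.
  by rewrite -[X in measurable X]setTI; apply: mfg => //; exact: measurable_set1.
by apply/seteqP; split => w /=; [move=> ->; rewrite subrr|move/subr0_eq].
Qed.

Lemma measurable_eq_pair_set (f g : W -> pt) : measurable_fun setT f ->
  measurable_fun setT g -> measurable [set w | f w = g w].
Proof.
move=> mf mg.
have m1 (h : W -> pt) : measurable_fun setT h -> measurable_fun setT (fun w => (h w).1).
  by move=> mh; exact: (measurableT_comp (@measurable_fst _ _ R R) mh).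
have m2 (h : W -> pt) : measurable_fun setT h -> measurable_fun setT (fun w => (h w).2).
  by move=> mh; exact: (measurableT_comp (@measurable_snd _ _ R R) mh).
rewrite (_ : [set w | _] = [set w | (f w).1 = (g w).1] `&` [set w | (f w).2 = (g w).2]).
  by apply: measurableI; apply: measurable_eq_set; solve [exact: m1|exact: m2].
apply/seteqP; split => w /=; first by move=> ->.
by case: (f w) (g w) => a b [a' b'] /= [-> ->].
Qed.

End level_sets.

Notation s3 := (Num.sqrt 3 : R).

(** Barycentric coordinates: they turn the existential descriptions of the triangle and of its
    vertex regions into linear inequalities, from which measurability follows. *)
Definition bary2 p : R := 2 * p.2 / s3.
Definition bary1 p : R := p.1 - bary2 p / 2.
Definition bary0 p : R := 1 - bary1 p - bary2 p.

Let s3_neq0 : s3 != 0. Proof. by rewrite gt_eqF// sqrtr_gt0. Qed.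

Lemma baryK p (a b c : R) : a + b + c = 1 ->
  p = padd (pscale a (vtx R 0)) (padd (pscale b (vtx R 1)) (pscale c (vtx R 2))) <->
  [/\ bary0 p = a, bary1 p = b & bary2 p = c].
Proof.
move=> abc; rewrite /bary0 /bary1 /bary2 /padd /pscale /vtx /=; split.
  move=> -> /=; have -> : a = 1 - b - c by rewrite -abc; ring.
  by split; field.
case: p => p1 p2 /= [<- <- <-]; congr pair; field; exact: s3_neq0.
Qed.

Lemma TriP p : Tri p <-> [/\ 0 <= bary0 p, 0 <= bary1 p & 0 <= bary2 p].
Proof.
split=> [[a [b [c [a0 b0 c0 abc]]]]|[a0 b0 c0]].
  by move=> /(baryK _ abc)[-> -> ->].
have abc : bary0 p + bary1 p + bary2 p = 1 by rewrite /bary0; ring.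
by exists (bary0 p), (bary1 p), (bary2 p); split => //; exact/(baryK _ abc).
Qed.

(** Inside the triangle, the region of a vertex is where its barycentric coordinate is the
    largest. *)
Lemma vregion0P p : @vregion R 0 p <->
  [/\ 0 <= bary1 p, 0 <= bary2 p, bary1 p <= bary0 p & bary2 p <= bary0 p].
Proof.
split.
  move=> [a [b [c [e [[a0 b0 c0 e0] [abce ->]]]]]].
  set q := padd _ _.
  have [-> -> ->] : [/\ bary0 q = a + b / 2 + c / 3 + e / 2, bary1 q = b / 2 + c / 3 &
      bary2 q = c / 3 + e / 2].
    rewrite /bary0 /bary1 /bary2 /q /MC /midpt /padd /pscale /vtx /=.
    have -> : a = 1 - b - c - e by rewrite -abce; ring.
    by split; field.
  by split; lra.
move=> [p1 p2 p10 p20].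
(* The centroid receives weight [3 m], which uses up the smaller of the two coordinates. The excess
   of the other goes to its edge midpoint with weight doubled, and the vertex takes what is left. *)
pose m := Num.min (bary1 p) (bary2 p).
have m0 : 0 <= m by rewrite le_min p1.
have m1 : m <= bary1 p by rewrite ge_min lexx.
have m2 : m <= bary2 p by rewrite ge_min lexx orbT.
have mE : bary1 p + bary2 p - m <= bary0 p.
  by rewrite /m; have [_|_] := leP (bary1 p) (bary2 p); lra.
exists (bary0 p - bary1 p - bary2 p + m), (2 * (bary1 p - m)), (3 * m), (2 * (bary2 p - m)).
split; first by split; lra.
split; first by rewrite /bary0; ring.
move: m => m in m0 m1 m2 mE *.
rewrite /bary0 /bary1 /bary2 /MC /midpt /padd /pscale /vtx /=.
by case: p p1 p2 p10 p20 m1 m2 mE => u v * /=; congr pair; field.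
Qed.

(** The image of [vregion0P] under the cyclic shift of the vertices. The third region is the default
    case of [vidx]. *)
Lemma vregion1P p : @vregion R 1 p <->
  [/\ 0 <= bary2 p, 0 <= bary0 p, bary2 p <= bary1 p & bary0 p <= bary1 p].
Proof.
split.
  move=> [a [b [c [e [[a0 b0 c0 e0] [abce ->]]]]]].
  set q := padd _ _.
  have [-> -> ->] : [/\ bary1 q = a + b / 2 + c / 3 + e / 2, bary2 q = b / 2 + c / 3 &
      bary0 q = c / 3 + e / 2].
    rewrite /bary0 /bary1 /bary2 /q /MC /midpt /padd /pscale /vtx /=.
    have -> : a = 1 - b - c - e by rewrite -abce; ring.
    by split; field.
  by split; lra.
move=> [p1 p2 p10 p20].
pose m := Num.min (bary2 p) (bary0 p).
have m0 : 0 <= m by rewrite le_min p1.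
have m1 : m <= bary2 p by rewrite ge_min lexx.
have m2 : m <= bary0 p by rewrite ge_min lexx orbT.
have mE : bary2 p + bary0 p - m <= bary1 p.
  by rewrite /m; have [_|_] := leP (bary2 p) (bary0 p); lra.
exists (bary1 p - bary2 p - bary0 p + m), (2 * (bary2 p - m)), (3 * m), (2 * (bary0 p - m)).
split; first by split; lra.
split; first by rewrite /bary0; ring.
move: m => m in m0 m1 m2 mE *.
rewrite /bary0 /bary1 /bary2 /MC /midpt /padd /pscale /vtx /=.
by case: p p1 p2 p10 p20 m1 m2 mE => u v * /=; congr pair; field.
Qed.

Let mfst : measurable_fun setT (fst : pt -> R). Proof. exact: measurable_fst. Qed.
Let msnd : measurable_fun setT (snd : pt -> R). Proof. exact: measurable_snd. Qed.

Lemma measurable_inv : measurable_fun setT (fun t : R => t^-1).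
Proof.
(* also at [t = 0], where both sides are [0] *)
have -> : (fun t : R => t^-1) = (fun t : R => t * expR (- 2 * ln `|t|)).
  apply/funext => x; have [->|x0] := eqVneq x 0; first by rewrite invr0 mul0r.
  have x0' : 0 < `|x| by rewrite normr_gt0.
  rewrite mulNr mulr_natl expRN mulr2n expRD lnK ?posrE// -expr2.
  by rewrite (real_normK (num_real x)) expr2 invfM mulrA divff// mul1r.
apply: measurable_funM => //; apply: measurableT_comp => //.
by apply: measurable_funM => //; apply: measurableT_comp.
Qed.

Lemma measurable_bary2 : measurable_fun setT bary2.
Proof. by apply: measurable_funM => //; exact: measurable_funM. Qed.

Lemma measurable_bary1 : measurable_fun setT bary1.
Proof.
by apply: measurable_funB => //; apply: measurable_funM => //; exact: measurable_bary2.
Qed.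

Lemma measurable_bary0 : measurable_fun setT bary0.
Proof.
apply: measurable_funB; last exact: measurable_bary2.
by apply: measurable_funB => //; exact: measurable_bary1.
Qed.

Lemma measurable_Tri : measurable (@Tri R).
Proof.
rewrite (_ : @Tri R = [set p | 0 <= bary0 p] `&` [set p | 0 <= bary1 p] `&`
    [set p | 0 <= bary2 p]).
  apply: measurableI; first apply: measurableI; apply: measurable_ge0_set.
  - exact: measurable_bary0.
  - exact: measurable_bary1.
  - exact: measurable_bary2.
apply/seteqP; split => p /=; first by move=> /TriP[? ? ?].
by move=> [[? ?] ?]; apply/TriP.
Qed.

Let measurable_le_fun (f g : pt -> R) : measurable_fun setT f -> measurable_fun setT g ->
  measurable [set p | f p <= g p].
Proof.
move=> mf mg; under eq_set => p do rewrite -subr_ge0.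
by apply: measurable_ge0_set; exact: measurable_funB.
Qed.

Lemma measurable_vregion0 : measurable (@vregion R 0).
Proof.
rewrite (_ : @vregion R 0 = ([set p | 0 <= bary1 p] `&` [set p | 0 <= bary2 p]) `&`
    ([set p | bary1 p <= bary0 p] `&` [set p | bary2 p <= bary0 p])).
  have m0 := measurable_bary0; have m1 := measurable_bary1; have m2 := measurable_bary2.
  by apply: measurableI; apply: measurableI;
    solve [exact: measurable_ge0_set|exact: measurable_le_fun].
apply/seteqP; split => p; first by move=> /vregion0P[? ? ? ?].
by move=> [[? ?] [? ?]]; apply/vregion0P.
Qed.

Lemma measurable_vregion1 : measurable (@vregion R 1).
Proof.
rewrite (_ : @vregion R 1 = ([set p | 0 <= bary2 p] `&` [set p | 0 <= bary0 p]) `&`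
    ([set p | bary2 p <= bary1 p] `&` [set p | bary0 p <= bary1 p])).
  have m0 := measurable_bary0; have m1 := measurable_bary1; have m2 := measurable_bary2.
  by apply: measurableI; apply: measurableI;
    solve [exact: measurable_ge0_set|exact: measurable_le_fun].
apply/seteqP; split => p; first by move=> /vregion1P[? ? ? ?].
by move=> [[? ?] [? ?]]; apply/vregion1P.
Qed.

Lemma measurable_vidx j : measurable [set x : pt | vidx x = j].
Proof.
have -> : [set x : pt | vidx x = j] =
    (@vregion R 0 `&` [set _ : pt | 0%N = j]) `|`
    (~` @vregion R 0 `&` ((@vregion R 1 `&` [set _ : pt | 1%N = j]) `|`
      (~` @vregion R 1 `&` [set _ : pt | 2%N = j]))).
  apply/seteqP; split => x /=; rewrite /vidx.
    have [/set_mem x0 <-|/negP] := boolP (x \in @vregion R 0); first by left.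
    rewrite inE => x0; have [/set_mem x1 <-|/negP] := boolP (x \in @vregion R 1).
      by right; split => //; left.
    by rewrite inE => x1 <-; right; split => //; right.
  case=> [[x0 <-]|[x0]]; first by rewrite mem_set.
  by rewrite memNset// => -[[x1 <-]|[x1 <-]]; [rewrite mem_set|rewrite memNset].
have mc (Q : Prop) : measurable [set _ : pt | Q].
  have [q|q] := pselect Q.
    by rewrite (_ : [set _ | _] = setT)//; apply/seteqP; split.
  by rewrite (_ : [set _ | _] = set0)//; apply/seteqP; split.
have m0 := measurable_vregion0; have m1 := measurable_vregion1.
apply: measurableU; first exact: measurableI.
apply: measurableI; first exact: measurableC.
apply: measurableU; first exact: measurableI.
by apply: measurableI => //; exact: measurableC.
Qed.

Lemma measurable_dvl j : measurable_fun setT (@dvl R j).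
Proof.
rewrite /dvl /dist_pt_line /cross /psub.
apply: measurable_funM => //; apply: measurableT_comp => //.
by apply: measurable_funB; apply: measurable_funM => //; exact: measurable_funB.
Qed.

(** Inverting the homothety turns an image into a preimage of the triangle. Ratio 0, which collapses
    the triangle to its vertex, is kept apart because the pairs range over the whole plane. *)
Lemma simtriP j (D : R) y : let c := D / dvl j (vtx R j.+1) in simtri j D y <->
  (c = 0 /\ y = vtx R j) \/
  (c <> 0 /\ Tri (padd (vtx R j) (pscale c^-1 (psub y (vtx R j))))).
Proof.
move=> c; rewrite /simtri -/c; have [c0|/eqP c0] := eqVneq c 0.
  split=> [[z _ <-]|[[_ ->]|[]//]].
    left; split=> //; rewrite c0 /padd /pscale /= !mul0r !addr0.
    by rewrite -surjective_pairing.
  exists (vtx R 0).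
    by exists 1, 0, 0; split => //; [ring|rewrite /padd /pscale /=; congr pair; ring].
  by rewrite c0 /padd /pscale /= !mul0r !addr0 -surjective_pairing.
have /eqP cn0 := c0.
split=> [[z zT <-]|[[]//|[_ yT]]].
  right; split => //; rewrite (_ : padd _ _ = z)//.
  rewrite /padd /pscale /psub /= [RHS]surjective_pairing.
  by congr pair; field.
eexists; first exact: yT.
rewrite /padd /pscale /psub /= [RHS]surjective_pairing.
by congr pair; field.
Qed.

Lemma measurable_simtri j (r' : R) :
  measurable [set z : pt * pt | simtri j (r' * dvl j z.1) z.2].
Proof.
pose c (z : pt * pt) := r' * dvl j z.1 / dvl j (vtx R j.+1).
have mc : measurable_fun setT c.
  apply: measurable_funM => //; apply: measurable_funM => //.
  by apply: (measurableT_comp (measurable_dvl j)); exact: measurable_fst.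
have m0 : measurable [set z | c z = 0] by exact: measurable_eq_set.
rewrite (_ : [set z | _] =
    ([set z | c z = 0] `&` [set z | z.2 = vtx R j]) `|`
    (~` [set z | c z = 0] `&`
     ((fun z => padd (vtx R j) (pscale (c z)^-1 (psub z.2 (vtx R j)))) @^-1` @Tri R))).
  apply: measurableU; apply: measurableI => //; [| exact: measurableC|].
    by apply: measurable_eq_pair_set => //; exact: measurable_snd.
  rewrite -[X in measurable X]setTI.
  suff : measurable_fun setT
      (fun z : pt * pt => padd (vtx R j) (pscale (c z)^-1 (psub z.2 (vtx R j)))).
    by apply => //; exact: measurable_Tri.
  have mi : measurable_fun setT (fun z => (c z)^-1).
    exact: (measurableT_comp measurable_inv mc).
  have m21 := measurableT_comp mfst (@measurable_snd _ _ pt pt).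
  have m22 := measurableT_comp msnd (@measurable_snd _ _ pt pt).
  apply: measurable_fun_pair; apply: measurable_funD => //; apply: measurable_funM => //;
    exact: measurable_funB.
by apply/seteqP; split => z /=; [move=> /simtriP|move=> h; apply/simtriP].
Qed.

(** Measurability must be joint in both points, since the kernel is integrated by Fubini. [mcase]
    isolates the vertices; for finite [r] the set is cut along the three values of [vidx], on each
    of which the homothety centre is fixed. *)
Lemma measurable_Nprox r : measurable [set z : pt * pt | Nprox r z.1 z.2].
Proof.
have mV : measurable [set z : pt * pt | vertY z.1].
  rewrite (_ : [set z | _] = [set z | z.1 = vtx R 0] `|` [set z | z.1 = vtx R 1] `|`
      [set z | z.1 = vtx R 2]).
    have mf := @measurable_fst _ _ pt pt.
    by apply: measurableU; first apply: measurableU; exact: measurable_eq_pair_set.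
  apply/seteqP; split => z /=.
    by case=> -[_ <-|[_ <-|[_ <-|//]]]; [left; left|left; right|right].
  by case=> [[->|->]|->]; [exists 0%N|exists 1%N|exists 2%N].
have mT : measurable [set z : pt * pt | Tri z.2].
  rewrite -[X in measurable X]setTI.
  by apply: (@measurable_snd _ _ pt pt) => //; exact: measurable_Tri.
have mcase (K : set (pt * pt)) : measurable K ->
    (forall z, ~ vertY z.1 -> Nprox r z.1 z.2 = K z) ->
    measurable [set z : pt * pt | Nprox r z.1 z.2].
  move=> mK NK; rewrite (_ : [set z | _] =
      ([set z | vertY z.1] `&` [set z | z.2 = z.1]) `|` (~` [set z | vertY z.1] `&` K)).
    apply: measurableU; apply: measurableI => //; last exact: measurableC.
    by apply: measurable_eq_pair_set; [exact: measurable_snd|exact: measurable_fst].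
  apply/seteqP; split => z /=; have [V|V] := pselect (vertY z.1).
  - by rewrite /Nprox mem_set// => ->; left.
  - by rewrite NK//; right.
  - by case=> -[// _]; rewrite /Nprox mem_set.
  - by case=> -[// _]; rewrite NK.
case: r mcase => [r'| |] mcase.
- pose A j := [set z : pt * pt | vidx z.1 = j] `&`
    [set z : pt * pt | simtri j (r' * dvl j z.1) z.2].
  have mA j : measurable (A j).
    apply: measurableI; last exact: measurable_simtri.
    have := @measurable_fst _ _ pt pt measurableT _ (measurable_vidx j).
    by rewrite setTI.
  apply: (mcase ((A 0%N `|` A 1%N `|` A 2%N) `&` [set z | Tri z.2])).
    by apply: measurableI => //; apply: measurableU => //; exact: measurableU.
  move=> z V; rewrite /Nprox memNset//; apply/propext; split.
    move=> [zs zT]; split => //; have : vidx z.1 = vidx z.1 by [].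
    rewrite {2}/vidx; case: ifP => _; last case: ifP => _.
    + by move=> zE; left; left; split => //; rewrite -zE.
    + by move=> zE; left; right; split => //; rewrite -zE.
    + by move=> zE; right; split => //; rewrite -zE.
  by move=> [[[[zE zs]|[zE zs]]|[zE zs]] zT]; split=> //; rewrite zE.
- by apply: (mcase [set z | Tri z.2]) => // z V; rewrite /Nprox memNset.
- by apply: (mcase [set z | Tri z.2]) => // z V; rewrite /Nprox memNset.
Qed.

End proximity_measurable.

(** * Covariance of bounded variables and application to the arc count *)

Section bounded_covariance.
Context {R : realType} d (W : measurableType d) (P : probability W R).

Lemma fine_expectation (f : W -> R) : fine 'E_P[f] = \int[P]_w f w.
Proof. by rewrite unlock. Qed.

Lemma fine_covariance (f g : W -> R) : bmeas f -> bmeas g ->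
  fine (covariance P f g) = \int[P]_w (f w * g w) - \int[P]_w f w * \int[P]_w g w.
Proof.
move=> bf bg; rewrite covariance.unlock !fine_expectation.
set a := \int[P]_w f w; set b := \int[P]_w g w.
transitivity (\int[P]_w (f w * g w - (b * f w + (a * g w - a * b)))).
  apply: eq_Rintegral => w _; rewrite -[LHS]/((f w - a) * (g w - b)); ring.
have bag : bmeas (fun w => a * g w - a * b).
  by apply: bmeasB; [exact: bmeasZ|exact: bmeas_cst].
rewrite RintB; [|exact: bmeasM|by apply: bmeasD => //; exact: bmeasZ].
rewrite RintD//; last exact: bmeasZ.
rewrite RintB; [|exact: bmeasZ|exact: bmeas_cst].
by rewrite Rint_cst !RintZ// -/a -/b; ring.
Qed.

End bounded_covariance.

Lemma clt_holds_of_iid_uniform (R : realType) (r : \bar R) (S : set (R * R))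
    (d : measure_display) (Omega : measurableType d) (P : probability Omega R)
    (X : nat -> Omega -> R * R) :
  iid_uniform P X S -> 0 < nu_h P X r ->
  clt_holds P X r (mu_h P X r) (nu_h P X r).
Proof.
move=> [mX lawX indepX] nu0 t.
have identX i A : measurable A -> P (X i @^-1` A) = P (X 0 @^-1` A).
  by move=> mA; rewrite !lawX.
pose k : (R * R) * (R * R) -> R := \1_[set z | Nprox r z.1 z.2].
have kE x y : k (x, y) = \1_(Nprox r x) y.
  by rewrite /k !indicE; congr (_%:R); congr nat_of_bool; apply/idP/idP; rewrite !inE.
have bk : bmeas k by apply: bmeas_indic; exact: measurable_Nprox.
have hE i j w : hij X r i j w = sym_kernel k (X i w, X j w).
  by rewrite /hij /sym_kernel /= !kE.
have bh i j : bmeas (hij X r i j).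
  rewrite (_ : hij X r i j = fun w => sym_kernel k (X i w, X j w)); last exact/funext.
  apply: (bmeas_comp (h := fun w => (X i w, X j w)) (bmeas_sym_kernel bk)).
  exact: measurable_fun_pair.
(* Decoupling from [X 0] gives [hij] the same mean for the index pairs (0, 1) and (0, 2), so the
   product of means in the covariance is [theta ^+ 2]. *)
have theta_h j : (0 < j)%N -> \int[P]_w hij X r 0 j w = kernel_mean P X k.
  move=> j0; have off l : (0 < l)%N -> l \notin [:: 0%N] by case: l.
  rewrite /kernel_mean; under eq_Rintegral => w _ do rewrite hE.
  have i0 := indep_off1 mX indepX 0.
  by rewrite (Rint_decouple mX identX i0 (off j j0) (bmeas_sym_kernel bk))
    (Rint_decouple mX identX i0 (off 1%N isT) (bmeas_sym_kernel bk)).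
have nuE : nu_h P X r = \int[P]_w (hajek P X k (X 0 w) ^+ 2).
  rewrite /nu_h fine_covariance// !theta_h// (Rint_hajek_sqr mX identX indepX bk) expr2.
  by congr (_ - _); apply: eq_Rintegral => w _; rewrite !hE.
have s0 : 0 < Num.sqrt (nu_h P X r) by rewrite sqrtr_gt0.
have sE : \int[P]_w (hajek P X k (X 0 w) ^+ 2) = Num.sqrt (nu_h P X r) ^+ 2.
  by rewrite sqr_sqrtr ?nuE// -nuE ltW.
have := ustat_cvg (t := t) mX identX indepX bk s0 sE.
rewrite (_ : mu_h P X r = kernel_mean P X k / 2); last first.
  by rewrite /mu_h fine_expectation theta_h.
by congr (_ --> _); congr fmap; apply/funext => n; congr (P _).
Qed.

Theorem theorem3 (R : realType) (r : \bar R) (eps : R) :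
  (1%:E <= r)%E -> 0 <= eps -> eps < Num.sqrt 3 / 3 ->
  (forall (d : measure_display) (Omega : measurableType d)
          (P : probability Omega R) (X : nat -> Omega -> (R * R)%type),
     iid_uniform P X (seg_support eps) ->
     0 < nu_h P X r ->
     clt_holds P X r (mu_h P X r) (nu_h P X r)) /\
  (forall (d : measure_display) (Omega : measurableType d)
          (P : probability Omega R) (X : nat -> Omega -> (R * R)%type),
     iid_uniform P X (assoc_support eps) ->
     0 < nu_h P X r ->
     clt_holds P X r (mu_h P X r) (nu_h P X r)).
Proof.
by move=> _ _ _; split=> d Omega P X; exact: clt_holds_of_iid_uniform.
Qed.
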